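(* There exists a pair $(u,\sigma)$ with $\sigma \in \mathcal{M}_+(S)$ and $u \in L^1((S,\sigma);X)$ that minimizes $$\inf_{\sigma \in \mathcal{M}_+(S),\ u \in L^1((S,\sigma);X)} \tfrac12\left\|A\int_S u(s)\,d\sigma(s) - f\right\|_Y^2 + \alpha\int_S J(u(s),s)\,d\sigma(s).$$ Consequently, the pair $\left(\int_S u(s)\,d\sigma(s),\sigma\right) \in X \times \mathcal{M}_+(S)$ minimizes $$\inf_{v \in X,\ \sigma \in \mathcal{M}_+(S)} \tfrac12\|Av-f\|_Y^2 + \alpha R(v,\sigma).$$
   Context: Setting: $X$ is a separable (real) Banach space that admits a predual $X_*$; $Y$ is a separable Hilbert space; $A : X \to Y$ is linear and weak*-to-weak continuous (i.e. the adjoint of some bounded linear operator $A_*: Y \to X_*$); $f \in Y$; $\alpha>0$; $S \subset \mathbb{R}^d$ ($d\in\mathbb{N}$) is non-empty and compact; $\mathcal{M}_+(S)$ is the set of finite positive Radon measures on $S$; $J : X \times S \to [0,+\infty]$ is a proper Borel-measurable functional satisfying: (H1) for every $s \in S$, $J(\cdot,s)$ is proper, convex and positively one-homogeneous, i.e. $J(\lambda v,s) = \lambda J(v,s)$ for all $\lambda \ge 0$, $v \in X$ (with $0\cdot(+\infty)=0$); (H2) $J$ is sequentially lower semicontinuous on $X \times S$, where $X$ carries the weak* topology; (H3) there is a constant $C>0$ with $\|v\|_X \le C J(v,s)$ for all $v \in X$, $s \in S$. The infinite infimal convolution is $R : X \times \mathcal{M}_+(S) \to [0,\infty]$, $$R(v,\sigma)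 = \inf\left\{\int_S J(u(s),s)\,d\sigma(s) : u \in L^1((S,\sigma);X),\ \int_S u(s)\,d\sigma(s) = v\right\},$$ with $L^1((S,\sigma);X)$ the Bochner space, Bochner integrals, and $\inf\emptyset = +\infty$. *)

(* Defs.v *)
From HB Require Import structures.
From mathcomp Require Import all_boot all_order all_algebra sesquilinear.
From mathcomp Require Import all_classical all_reals all_analysis.
From mathcomp Require Import measurable_realfun.

Set Implicit Arguments.
Unset Strict Implicit.
Unset Printing Implicit Defensive.

Import Order.TTheory GRing.Theory Num.Theory.
Import numFieldNormedType.Exports.

Local Open Scope classical_set_scope.
Local Open Scope ring_scope.

Notation borel T := (g_sigma_algebraType (@open T)).

Definition separable (T : topologicalType) := exists2 D : set T, countable D & dense D.

Section duality.
Context {R : realType}.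

Definition topological_dual (V : normedModType R) : set (V -> R) :=
  [set phi : V -> R | scalar phi /\ continuous phi].

Arguments topological_dual : clear implicits.

Definition dual_norm (V : normedModType R) (phi : V -> R) : R :=
  sup [set `|phi x| | x in [set x | `|x| <= 1]].

(* [iota] is an isometric linear isomorphism of X onto the dual of Xs; [iota v w]
   is the pairing of v and w *)
Definition is_predual (X Xs : normedModType R) (iota : X -> Xs -> R) :=
  [/\ forall a v1 v2 w, iota (a *: v1 + v2) w = a * iota v1 w + iota v2 w,
      range iota = topological_dual Xs
    & forall v, `|v| = dual_norm (iota v)].

Definition weak_star (X Xs : normedModType R) (iota : X -> Xs -> R) :
    topologicalType :=
  initial_topology (iota : X -> {ptws Xs -> R}).

Definition weak (V : normedModType R) : topologicalType :=
  initial_topology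
    ((fun v phi => \val phi v) : V -> {ptws topological_dual V -> R}).

Definition weak_star_to_weak_continuous (X Xs Y : normedModType R)
    (iota : X -> Xs -> R) (A : X -> Y) :=
  continuous (A : weak_star iota -> weak Y).

Definition is_inner_product (Y : normedModType R) (ip : {dot Y for @idfun R}) :=
  forall y, `|y| ^+ 2 = ip y y.

End duality.

Section functionals.
Context {R : realType}.

(* Properness and convexity of a functional with values in [0, +oo], or at
   least in ]-oo, +oo]; in \bar R, 0 * +oo = 0 *)
Definition proper_on {T : Type} (D : set T) (F : T -> \bar R) :=
  (forall x, D x -> F x != -oo%E) /\ (exists2 x, D x & F x != +oo%E).

Definition convex_ereal (V : lmodType R) (F : V -> \bar R) :=
  forall (t : R) (v w : V), 0 <= t <= 1 ->
    (F (t *: v + (1 - t) *: w)%R <= t%:E * F v + (1 - t)%:E * F w)%E.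

Definition pos_homogeneous (V : lmodType R) (F : V -> \bar R) :=
  forall (l : R) v, 0 <= l -> F (l *: v) = (l%:E * F v)%E.

Definition borel_measurable_on (T U : ptopologicalType) (D : set (T * U))
    (F : T * U -> \bar R) :=
  measurable_fun (D : set (borel (T * U)%type))
                 (F : borel (T * U)%type -> \bar R).

Definition seq_lsc_on (T : topologicalType) (D : set T) (F : T -> \bar R) :=
  forall (x_ : nat -> T) (x : T), (forall n, D (x_ n)) -> D x ->
    x_ @ \oo --> x -> (F x <= limn_einf (F \o x_))%E.

End functionals.

Section bochner.
Context d {T : measurableType d} {R : realType} {X : normedModType R}.
Implicit Types (D : set T) (g u : T -> X).

Definition simple_function g :=
  finite_set (range g) /\ forall x, measurable (g @^-1` [set x]).

(* everywhere pointwise limits on D, and not just almost everywhere ones: every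
   class of L^1 has such a representative, and u is then Borel on D, so that the
   integrands `|u| and J(u(s), s) below are measurable *)
Definition strongly_measurable D u := exists2 g : nat -> T -> X,
  (forall n, simple_function (g n)) & forall t, D t -> g ^~ t @ \oo --> u t.

Variable mu : {finite_measure set T -> \bar R}.

Definition bochner_L1 D : set (T -> X) := [set u |
  strongly_measurable D u /\ (\int[mu]_(t in D) `|u t|%:E < +oo)%E].

Definition simple_integral D g : X :=
  \sum_(x \in range g) fine (mu (D `&` g @^-1` [set x])) *: x.

Definition is_bochner_integral D u (v : X) := exists g : nat -> T -> X,
  [/\ forall n, simple_function (g n),
      (fun n => \int[mu]_(t in D) `|u t - g n t|%:E)%E @ \oo --> 0%E
    & (fun n => simple_integral D (g n)) @ \oo --> v].

(* exactly one v qualifies if X is complete, D measurable and u in bochner_L1 *)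
Definition bochner_integral D u : X := xget 0 (is_bochner_integral D u).

End bochner.

Section infimal_convolution.
Context {R : realType} {d : nat}.
Local Notation E := 'rV[R]_d.

(* M_+(S): a finite Radon measure on S is encoded by its extension by zero to
   R^d, that is, by a finite Radon measure on R^d that is concentrated on S *)
Definition Mplus (S : set E) : set {finite_measure set (borel E) -> \bar R} :=
  [set sigma | sigma (~` S) = 0%E /\
    forall B : set (borel E), measurable B ->
      sigma B = ereal_sup [set sigma K | K in
        [set K : set (borel E) | compact (K : set E) /\ K `<=` B]]].

Context {X Y : normedModType R}.
Variables (J : X -> E -> \bar R) (S : set E).
Implicit Types (sigma : {finite_measure set (borel E) -> \bar R}) (u : E -> X).

Definition energy u sigma : \bar R := (\int[sigma]_(s in S) J (u s) s)%E.

Definition inf_conv (v : X) sigma : \bar R :=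
  ereal_inf [set energy u sigma |
    u in [set u : E -> X | bochner_L1 sigma S u /\ bochner_integral sigma S u = v]].

Variables (A : X -> Y) (f : Y) (alpha : R).

Definition objective_L1 u sigma : \bar R :=
  ((`|A (bochner_integral sigma S u) - f| ^+ 2 / 2)%:E
     + alpha%:E * energy u sigma)%E.

Definition objective v sigma : \bar R :=
  ((`|A v - f| ^+ 2 / 2)%:E + alpha%:E * inf_conv v sigma)%E.

End infimal_convolution.

(* Main.v *)
Require Import Defs.
From HB Require Import structures.
From mathcomp Require Import all_boot all_order all_algebra sesquilinear.
From mathcomp Require Import all_classical all_reals all_analysis.
From mathcomp Require Import measurable_realfun.
From mathcomp Require Import ring lra.

Set Implicit Arguments.
Unset Strict Implicit.
Unset Printing Implicit Defensive.

Import Order.TTheory GRing.Theory Num.Theory.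
Import numFieldNormedType.Exports.

Local Open Scope classical_set_scope.
Local Open Scope ring_scope.

(** Homogeneity is what turns energy into mass: scaling a vector by its value of [J] moves that
    value into the measure, and since the measure is free, only vectors of the unit sets are ever
    needed.

    The obstacle is that Hahn-Banach gives a mean that is merely finitely additive, on a set of
    pairs that is compact only in the sequential sense matching (H2). The mean is therefore not
    represented on the pairs themselves. Its values on countably many superlevel sets are copied
    onto subsets of the line, where Lebesgue measure is countably additive; compactness only serves
    to attach to each point of the line a pair with the right values.

    The vector-valued conditional expectation is likewise avoided: Radon-Nikodym is applied to the
    scalar pairings with countably many elements of the predual, and for almost every s the
    resulting numbers are reassembled into one functional on the predual. This rests on separability
    of the predual, which is deduced from that of X. *)

(** Let K(s) be the unit set {v | J(v, s) <= 1}. A vector v is the integral of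
some u with energy at most m if and only if <v, w> <= m h(w) for all w in the
predual, where h is the support function of the union of the K(s): one
direction is immediate from <u(s), w> <= h(w) J(u(s), s). For the other, the
inequality says, by Hahn-Banach, that w |-> <v, w> extends to a mean of mass m
on the bounded functions on the set of pairs (v', s) with v' in K(s). Applied to
countably many functions that separate the pairs, and by sequential
compactness, the mean becomes integration along a curve t |-> (V(t), s(t)) for a
measure on the line. Let sigma be the image of that measure under s, and u the
conditional expectation of V given s. Since K(s) is weak*-closed and convex, u(s)
is in K(s) for almost every s, so the energy of u is at most sigma(S) = m.

The problem thus amounts to minimizing |Av - f|^2 / 2 + alpha m over the pairs
(v, m) that satisfy the inequality, a condition that is stable under limits. The
direct method applies because m is bounded along a minimizing sequence and
bounds the norm of v. *)

(** * Hahn-Banach *)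

Section hahn_banach.
Context {R : realType} {V : lmodType R}.
Implicit Types p q : V -> R.

Definition sublinear p :=
  (forall x y, p (x + y) <= p x + p y) /\
  (forall a x, 0 < a -> p (a *: x) = a * p x).

Lemma sublinear0 p : sublinear p -> p 0 = 0.
Proof. by move=> [_ /(_ 2 0 (ltr0Sn R 1))]; rewrite scaler0; lra. Qed.

Lemma sublinearN_ge p x : sublinear p -> - p (- x) <= p x.
Proof. by move=> ps; have := ps.1 x (- x); rewrite subrr (sublinear0 ps); lra. Qed.

(** For sublinear [p], this is the greatest sublinear functional below [p] whose value at [- x0] is
    at most [- p x0]. *)
Definition tilt p x0 x := inf [set p (x + t *: x0) - t * p x0 | t in [set t | 0 <= t]].

Section tilt.
Variables (p : V -> R) (x0 : V).
Hypothesis ps : sublinear p.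

Let lbd x t : 0 <= t -> - p (- x) <= p (x + t *: x0) - t * p x0.
Proof.
move=> t0; have pt : t * p x0 = p (t *: x0).
  have [t1|t1] := ltP 0 t; first by rewrite ps.2.
  have -> : t = 0 by lra.
  by rewrite scale0r mul0r (sublinear0 ps).
have := ps.1 (x + t *: x0) (- x); rewrite addrAC subrr add0r pt.
by lra.
Qed.

Lemma tilt_le x t : 0 <= t -> tilt p x0 x <= p (x + t *: x0) - t * p x0.
Proof.
move=> t0; apply: ge_inf; last by exists t.
by exists (- p (- x)) => _ [s /= s0 <-]; exact: lbd.
Qed.

Lemma tilt_ge x y : (forall t, 0 <= t -> y <= p (x + t *: x0) - t * p x0) ->
  y <= tilt p x0 x.
Proof.
move=> H; apply: lb_le_inf; first by exists (p (x + 0 *: x0) - 0 * p x0); exists 0 => /=.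
by move=> _ [t /= t0 <-]; exact: H.
Qed.

Lemma sublinear_tilt : sublinear (tilt p x0).
Proof.
split=> [x y|a x a0].
  rewrite -lerBlDr; apply: tilt_ge => t t0.
  rewrite lerBlDr [leRHS]addrC -lerBlDr; apply: tilt_ge => s s0.
  have := @tilt_le (x + y) (s + t) (addr_ge0 s0 t0).
  have := ps.1 (x + t *: x0) (y + s *: x0).
  have -> : x + t *: x0 + (y + s *: x0) = x + y + (s + t) *: x0.
    by rewrite scalerDl addrACA [s *: _ + _]addrC.
  by lra.
apply/eqP; rewrite eq_le; apply/andP; split.
  rewrite mulrC -ler_pdivrMr //; apply: tilt_ge => t t0.
  rewrite ler_pdivrMr // mulrBl.
  have := @tilt_le (a *: x) (a * t) (mulr_ge0 (ltW a0) t0).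
  by rewrite -scalerA -scalerDr ps.2 //; lra.
apply: tilt_ge => t t0.
have := @tilt_le x (t / a) (divr_ge0 t0 (ltW a0)).
rewrite -(ler_pM2l a0) => /le_trans; apply.
rewrite mulrBr -(ps.2 a (x + _)) // scalerDr scalerA mulrCA divff ?gt_eqF// mulr1.
by rewrite mulrA mulrCA divff ?gt_eqF// mulr1.
Qed.

End tilt.

(** Zorn's lemma for the reversed pointwise order. The infimum along a chain is finite because a
    sublinear functional below [p] is at least [- p (- x)] at [x]. *)
Lemma minimal_sublinear p : sublinear p -> exists q,
  [/\ sublinear q, (forall x, q x <= p x) &
   forall r, sublinear r -> (forall x, r x <= q x) -> forall x, q x <= r x].
Proof.
move=> ps.
pose T := {q : V -> R | sublinear q /\ forall x, q x <= p x}.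
pose ord (s t : T) := `[< forall x, sval t x <= sval s x >].
have t0 : T by exists p.
have [t|r s t|A Atot|[q [qs qp]] qmin] := @ZL_preorder T t0 ord.
- exact/asboolP.
- move=> /asboolP rs /asboolP st; apply/asboolP => x.
  exact: le_trans (st x) (rs x).
- have [[a0 Aa0]|A0] := pselect (A !=set0); last first.
    by exists t0 => s As; case: A0; exists s.
  pose m x := inf [set sval s x | s in A].
  have Alb x : has_lbound [set sval s x | s in A].
    exists (- p (- x)) => _ [s As <-].
    have := sublinearN_ge x (svalP s).1; have := (svalP s).2 (- x); lra.
  have m_le s x : A s -> m x <= sval s x.
    by move=> As; apply: ge_inf => //; exists s.
  have m_ge y x : (forall s, A s -> y <= sval s x) -> y <= m x.
    move=> H; apply: lb_le_inf; first by exists (sval a0 x), a0.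
    by move=> _ [s As <-]; exact: H.
  have ms : sublinear m.
    split=> [x y|a x a_gt0].
      rewrite -lerBlDr; apply: (m_ge _ _) => s As.
      rewrite lerBlDr [leRHS]addrC -lerBlDr; apply: (m_ge _ _) => t At.
      rewrite lerBlDr.
      (* Subadditivity of the infimum uses the chain: the smaller of [s] and [t] bounds [m (x + y)]
         and lies below both. *)
      have [/asboolP st|/asboolP ts] := Atot _ _ As At.
        have := (svalP t).1.1 x y; have := st x; have := m_le _ (x + y) At; lra.
      have := (svalP s).1.1 x y; have := ts y; have := m_le _ (x + y) As; lra.
    apply/eqP; rewrite eq_le; apply/andP; split.
      rewrite mulrC -ler_pdivrMr //; apply: (m_ge _ _) => s As.
      by rewrite ler_pdivrMr // mulrC -(svalP s).1.2 //; exact: m_le.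
    apply: (m_ge _ _) => s As; rewrite (svalP s).1.2 // ler_pM2l //; exact: m_le.
  have mp x : m x <= p x by apply: le_trans ((svalP a0).2 x); exact: m_le.
  by exists (exist _ m (conj ms mp)) => s As; apply/asboolP => x /=; exact: m_le.
- exists q; split => // r rs rq x.
  have rp y : r y <= p y by exact: le_trans (rq y) (qp y).
  have /= := qmin (exist _ r (conj rs rp)); move=> /(_ (introT (asboolP _) rq)).
  by move=> /asboolP /(_ x).
Qed.

(* A minimal sublinear functional q is linear: tilting q at x gives a smaller
   one, which by minimality equals q, so that q (- x) <= - q x. *)
Theorem hahn_banach p x0 : sublinear p -> exists L : V -> R,
  [/\ scalar L, (forall x, L x <= p x) & L x0 = p x0].
Proof.
(* Minimizing below the tilt at [x0] forces [q (- x0) <= - p x0], hence [q x0 = p x0] once [q] is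
   linear. *)
move=> ps; have [q [qs qp qmin]] := minimal_sublinear (sublinear_tilt x0 ps).
have qN x : q (- x) = - q x.
  have := qmin _ (sublinear_tilt x qs).
  have H y : tilt q x y <= q y.
    by have := tilt_le x qs y (lexx 0); rewrite scale0r addr0 mul0r subr0.
  move=> /(_ H (- x)).
  have := tilt_le x qs (- x) ler01; rewrite scale1r addNr (sublinear0 qs) mul1r.
  have := sublinearN_ge x qs; lra.
have qD x y : q (x + y) = q x + q y.
  apply/eqP; rewrite eq_le qs.1 /=.
  by have := qs.1 (- x) (- y); rewrite -opprD !qN; lra.
have qZ a x : q (a *: x) = a * q x.
  have [a0|a0|->] := ltgtP a 0; last by rewrite scale0r mul0r (sublinear0 qs).
    have -> : a *: x = - ((- a) *: x) by rewrite scaleNr opprK.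
    by rewrite qN qs.2 ?oppr_gt0 // mulNr opprK.
  by rewrite qs.2.
have pt y : tilt p x0 y <= p y.
  by have := tilt_le x0 ps y (lexx 0); rewrite scale0r addr0 mul0r subr0.
exists q; split=> [a x y|x|].
- by rewrite qD qZ.
- exact: le_trans (qp x) (pt x).
- apply/eqP; rewrite eq_le (le_trans (qp x0) (pt x0)) /=.
  have := qp (- x0); have := tilt_le x0 ps (- x0) ler01.
  by rewrite scale1r addNr (sublinear0 ps) mul1r qN; lra.
Qed.

End hahn_banach.

Section scalar_functions.
Context {R : realType} {V : lmodType R} {phi : V -> R}.
Hypothesis phis : scalar phi.

Lemma scalar_fun0 : phi 0 = 0.
Proof. by have := phis (- 1) 0 0; rewrite scaler0 addr0 mulN1r addNr. Qed.

Lemma scalar_funD x y : phi (x + y) = phi x + phi y.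
Proof. by have := phis 1 x y; rewrite scale1r mul1r. Qed.

Lemma scalar_funZ a x : phi (a *: x) = a * phi x.
Proof. by have := phis a x 0; rewrite !addr0 scalar_fun0 addr0. Qed.

Lemma scalar_funN x : phi (- x) = - phi x.
Proof. by rewrite -scaleN1r scalar_funZ mulN1r. Qed.

Lemma scalar_funB x y : phi (x - y) = phi x - phi y.
Proof. by rewrite scalar_funD scalar_funN. Qed.

Lemma scalar_fun_sum I (r : seq I) (F : I -> V) :
  phi (\sum_(i <- r) F i) = \sum_(i <- r) phi (F i).
Proof. by apply: big_morph; [exact: scalar_funD|exact: scalar_fun0]. Qed.

End scalar_functions.

Section bounded_functionals.
Context {R : realType} {V : normedModType R}.
Implicit Types phi : V -> R.

Lemma continuous_scalar_bounded phi : scalar phi -> continuous phi ->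
  exists M, forall x, `|x| <= 1 -> `|phi x| <= M.
Proof.
move=> phis /(_ 0) /cvgrPdist_lt /(_ 1 ltr01); rewrite (scalar_fun0 phis).
move=> /nbhs_ballP [e /= e0 ball1]; exists (2 / e) => x x1.
have xe : ball (0 : V) e ((e / 2) *: x).
  rewrite -ball_normE /= sub0r normrN normrZ gtr0_norm ?divr_gt0//.
  apply: (@le_lt_trans _ _ (e / 2)); last lra.
  by rewrite ler_piMr // divr_ge0 // ltW.
have := ball1 _ xe; rewrite sub0r normrN scalar_funZ // normrM gtr0_norm ?divr_gt0//.
rewrite mulrC -ltr_pdivlMr ?divr_gt0// invf_div mul1r.
exact: ltW.
Qed.

Lemma bounded_scalar_continuous phi (M : R) : scalar phi ->
  (forall x, `|phi x| <= M * `|x|) -> continuous phi.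
Proof.
move=> phis phiM x; apply/cvgrPdist_lt => e e0.
have M0 : 0 < `|M| + 1 by rewrite ltr_pwDr.
near=> y; rewrite -scalar_funB //; apply: (le_lt_trans (phiM _)).
apply: (@le_lt_trans _ _ ((`|M| + 1) * `|x - y|)).
  by rewrite ler_wpM2r // (le_trans (ler_norm _)) // lerDl.
rewrite mulrC -ltr_pdivlMr //.
by near: y; apply: cvgr_dist_lt => //; exact: divr_gt0.
Unshelve. all: by end_near. Qed.

End bounded_functionals.

(** * Separable preduals *)

Section predual.
Context {R : realType} {X Xs : normedModType R} {iota : X -> Xs -> R}.
Hypothesis predualX : is_predual iota.

Lemma pairing_dual v : topological_dual (iota v).
Proof. by have [_ <- _] := predualX; exists v. Qed.

Lemma pairing_scalar v : scalar (iota v).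
Proof. exact: (pairing_dual v).1. Qed.

Lemma pairing_scalarl w : scalar (iota ^~ w).
Proof. by have [il _ _] := predualX => a u v /=; rewrite il. Qed.

Lemma pairing_le v w : `|iota v w| <= `|v| * `|w|.
Proof.
have [_ _ ->] := predualX; have [M HM] :=
  continuous_scalar_bounded (pairing_scalar v) (pairing_dual v).2.
have ub x : `|x| <= 1 -> `|iota v x| <= dual_norm (iota v).
  move=> x1; apply: ub_le_sup; last by exists x.
  by exists M => _ [y /= y1 <-]; exact: HM.
have [->|w0] := eqVneq w 0.
  by rewrite (scalar_fun0 (pairing_scalar v)) !normr0 mulr0.
have nw : 0 < `|w| by rewrite normr_gt0.
have := ub (`|w|^-1 *: w).
rewrite normrZ normfV normr_id mulVf ?gt_eqF// => /(_ (lexx _)).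
rewrite (scalar_funZ (pairing_scalar v)) normrM normfV normr_id.
by rewrite mulrC ler_pdivrMr.
Qed.

Lemma le_pairing_norm v w : iota v w <= `|v| * `|w|.
Proof. exact: le_trans (ler_norm _) (pairing_le v w). Qed.

Lemma norm_le_pairing v M : (forall w, `|w| <= 1 -> `|iota v w| <= M) -> `|v| <= M.
Proof.
move=> H; have [_ _ ->] := predualX; apply: ge_sup.
  by exists `|iota v 0|; exists 0 => //=; rewrite normr0.
by move=> _ [x /= x1 <-]; exact: H.
Qed.

Lemma dual_representation (phi : Xs -> R) M : scalar phi ->
  (forall w, `|phi w| <= M * `|w|) -> exists v, iota v = phi.
Proof.
move=> phis phiM; have [_ ir _] := predualX.
have : topological_dual phi by split => //; exact: bounded_scalar_continuous phiM.
by rewrite -ir => -[v _ <-]; exists v.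
Qed.

Lemma pairing_inj v v' : (forall w, iota v w = iota v' w) -> v = v'.
Proof.
move=> vv'; apply/eqP; rewrite -subr_eq0 -normr_le0; apply: norm_le_pairing => w _.
by rewrite (scalar_funB (pairing_scalarl w)) vv' subrr normr0.
Qed.

End predual.

Section rational_span.
Context {R : realType} {V : normedModType R}.
Variable z : nat -> V.
Implicit Types l : seq (rat * nat).

(** Combinations are indexed by lists of coefficients and indices, a [countType], so that null sets
    and measurable sets indexed by them can be united. Concatenation of lists is addition. *)
Definition qspan l : V := \sum_(p <- l) ratr p.1 *: z p.2.

Definition qscale (q : rat) l := [seq (q * p.1, p.2) | p <- l].

Lemma qspan_cat l1 l2 : qspan (l1 ++ l2) = qspan l1 + qspan l2.
Proof. by rewrite /qspan big_cat. Qed.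

Lemma qspan_scale q l : qspan (qscale q l) = ratr q *: qspan l.
Proof.
rewrite /qspan /qscale big_map scaler_sumr; apply: eq_bigr => p _ /=.
by rewrite rmorphM scalerA.
Qed.

Lemma qspan1 n : qspan [:: (1, n)] = z n.
Proof. by rewrite /qspan big_seq1 /= rmorph1 scale1r. Qed.

Lemma qspan_nil : qspan [::] = 0.
Proof. by rewrite /qspan big_nil. Qed.

Definition qdense := forall w e, 0 < e -> exists l, `|w - qspan l| < e.

Definition qdist x := inf [set `|x - qspan l| | l in [set: seq (rat * nat)]].

Lemma qdist_le x l : qdist x <= `|x - qspan l|.
Proof. by apply: ge_inf; [exists 0 => _ [? _ <-]|exists l]. Qed.

Lemma qdist_ge x y : (forall l, y <= `|x - qspan l|) -> y <= qdist x.
Proof.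
move=> H; apply: lb_le_inf; first by exists `|x - qspan [::]|, [::].
by move=> _ [l _ <-].
Qed.

Lemma qdist_le_norm x : qdist x <= `|x|.
Proof. by have := qdist_le x [::]; rewrite qspan_nil subr0. Qed.

Lemma qdistD x y : qdist (x + y) <= qdist x + qdist y.
Proof.
rewrite -lerBlDr; apply: qdist_ge => l; rewrite lerBlDr [leRHS]addrC -lerBlDr.
apply: qdist_ge => k; rewrite lerBlDr.
apply: (le_trans (qdist_le _ (k ++ l))).
by rewrite qspan_cat opprD (addrC x) addrACA ler_normD.
Qed.

Lemma qdist_scale_rat (q : rat) x : 0 < q -> qdist (ratr q *: x) <= ratr q * qdist x.
Proof.
move=> q0; have rq : 0 < ratr q :> R by rewrite ltr0q.
rewrite -ler_pdivrMl //; apply: qdist_ge => l; rewrite ler_pdivrMl //.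
apply: (le_trans (qdist_le _ (qscale q l))).
by rewrite qspan_scale -scalerBr normrZ gtr0_norm.
Qed.

(** The rational span is not stable under real scalars, but [a] can be replaced by a slightly larger
    rational [q] at the cost [(q - a) * (qdist x + |x|)]; the chosen window for [q] makes this at
    most [e]. *)
Lemma qdist_scale_le a x : 0 < a -> qdist (a *: x) <= a * qdist x.
Proof.
move=> a0; apply/ler_addgt0Pr => e e0.
have C0 : 0 < `|x| + qdist x + 1.
  by have := qdist_ge (fun l => normr_ge0 (x - qspan l)); have := normr_ge0 x; lra.
have [q /[!in_itv]/andP[/= aq qa]] :=
  @rat_in_itvoo R a (a + e / (`|x| + qdist x + 1)) ltac:(by rewrite ltrDl divr_gt0).
have q0 : 0 < q by rewrite -(@ltr0q R); lra.
have := qdist_scale_rat x q0.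
have := qdistD (ratr q *: x) ((a - ratr q) *: x).
have -> : ratr q *: x + (a - ratr q) *: x = a *: x by rewrite -scalerDl addrC subrK.
have := qdist_le_norm ((a - ratr q) *: x); rewrite normrZ ltr0_norm; last lra.
have : (ratr q - a) * (`|x| + qdist x + 1) <= e.
  by rewrite -ler_pdivlMr //; lra.
by nra.
Qed.

Lemma sublinear_qdist : sublinear qdist.
Proof.
split; first exact: qdistD.
move=> a x a0; apply/eqP; rewrite eq_le qdist_scale_le //=.
rewrite -ler_pdivlMl //; have := @qdist_scale_le a^-1 (a *: x).
by rewrite invr_gt0 scalerA mulVf ?gt_eqF// scale1r; exact.
Qed.

End rational_span.

Lemma separable_dense_seq (R : realType) (X : normedModType R) : separable X ->
  exists v : nat -> X, forall x e, 0 < e -> exists n, `|x - v n| < e.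
Proof.
move=> [D cD dD].
have D0 : D !=set0.
  by have [|x [_ Dx]] := dD setT _ openT; [exists 0|exists x].
have /pfcard_geP [D_0|[f]] := cD; first by rewrite D_0 in D0; case: D0.
exists f => x e e0.
have [|y [xy Dy]] := dD (ball x e) _ (ball_open x e).
  by exists x; exact: ballxx.
have [n _ fn] := @surj _ _ _ _ f y Dy.
by exists n; rewrite fn; move: xy; rewrite -ball_normE.
Qed.

(* Otherwise Hahn-Banach, applied to the distance to the span of a norming
   sequence z, yields a functional that is nonzero and vanishes on z. *)
Lemma separable_predual (R : realType) (X Xs : normedModType R)
    (iota : X -> Xs -> R) : separable X -> is_predual iota ->
  exists z : nat -> Xs, qdense z.
Proof.
move=> sepX pX; have [v vdense] := separable_dense_seq sepX.
have normed n : exists w, `|w| <= 1 /\ `|v n| / 2 <= `|iota (v n) w|.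
  apply: contrapT => /forallNP H.
  have v2 : `|v n| <= `|v n| / 2.
    apply: (norm_le_pairing pX) => w w1; rewrite leNgt; apply/negP => lt.
    by apply: (H w); split => //; exact: ltW.
  have v0 : v n = 0 by apply/eqP; rewrite -normr_le0; lra.
  by apply: (H 0); rewrite v0 !normr0 mul0r.
have [z zP] := choice normed.
exists z => w e e0; apply: contrapT => /forallNP far.
have dw : e <= qdist z w.
  by apply: qdist_ge => l; rewrite leNgt; apply/negP => /far.
have [L [Ls Lp Lw]] := hahn_banach w (sublinear_qdist z).
have LM x : `|L x| <= 1 * `|x|.
  rewrite mul1r ler_norml -lerNl -(scalar_funN Ls) -{1}(normrN x).
  by rewrite !(le_trans (Lp _) (qdist_le_norm z _)).
have [phi phiE] := dual_representation pX Ls LM.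
have Lz n : L (z n) = 0.
  have h1 := le_trans (Lp (z n)) (qdist_le z (z n) [:: (1, n)]).
  have h2 := le_trans (Lp (- z n)) (qdist_le z (- z n) [:: (-1, n)]).
  move: h1 h2; rewrite qspan1 subrr normr0 (scalar_funN Ls).
  rewrite /qspan big_seq1 /= rmorphN rmorph1 scaleN1r subrr normr0.
  by lra.
have phi0 : phi = 0.
  (* Since [phi] vanishes at [z n], which norms [v n] up to the factor 2,
     [|v n| <= 2 * |phi - v n|], so [|phi| <= 3 * |phi - v n|]; hence the tolerance [d / 3]. *)
  apply/eqP; rewrite -normr_le0; apply/ler_addgt0Pr => d d0; rewrite add0r.
  have [n vn] := vdense phi (d / 3) ltac:(by rewrite divr_gt0).
  have [zn1 zn2] := zP n.
  have : `|iota (v n) (z n)| <= `|phi - v n|.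
    have -> : iota (v n) (z n) = iota (v n - phi) (z n).
      by rewrite (scalar_funB (pairing_scalarl pX _)) phiE Lz subr0.
    rewrite distrC; apply: (le_trans (pairing_le pX _ _)).
    by rewrite ler_piMr.
  have := ler_normD (phi - v n) (v n); rewrite subrK.
  by lra.
have : L w = 0.
  by rewrite -phiE phi0 (scalar_fun0 (pairing_scalarl pX _)).
by rewrite Lw; lra.
Qed.

(** * Means on bounded functions and their representation by measures *)

Section bounded_functions.
Context {R : realType} {T : Type}.

Definition is_bounded (f : T -> R) := exists M, forall t, `|f t| <= M.

Definition bounded_pred : {pred (T -> R)} := fun f => `[< is_bounded f >].

Lemma bounded_submod_closed : submod_closed bounded_pred.
Proof.
split; first by apply/asboolP; exists 0 => t; rewrite normr0.
move=> a f g /asboolP[M fM] /asboolP[N gN]; apply/asboolP.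
exists (`|a| * M + N) => t; apply: (le_trans (ler_normD _ _)).
by apply: lerD => //; rewrite normrM ler_wpM2l.
Qed.

HB.instance Definition _ :=
  GRing.isSubmodClosed.Build R (T -> R) bounded_pred bounded_submod_closed.

Record bounded_fun := BoundedFun {
  bounded_val :> T -> R; _ : bounded_val \in bounded_pred }.

HB.instance Definition _ := [isSub for bounded_val].
HB.instance Definition _ := [Choice of bounded_fun by <:].
HB.instance Definition _ := [SubChoice_isSubLmodule of bounded_fun by <:].

Lemma bounded_funP (f : bounded_fun) : is_bounded f.
Proof. exact/asboolP/(valP f). Qed.

End bounded_functions.

Section mean.
Context {R : realType} {T : Type} {W : lmodType R}.
Variables (x : W -> T -> R) (l : W -> R) (m : R).
Hypotheses (xs : forall t, scalar (x ^~ t))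
  (xb : forall w, is_bounded (x w)) (ls : scalar l)
  (lx : forall w M, (forall t, x w t <= M) -> l w <= m * M).

Let V := @bounded_fun R T.

(** These are the upper bounds that the wanted properties force on the value at [f]: a mean of mass
    [m] extending [l] sends anything below [x w + M] to at most [m * M + l w]. Their infimum [p] is
    thus the functional to dominate with. *)
Let majorants (f : V) : set R :=
  [set r | exists w M, (forall t, f t <= x w t + M) /\ r = m * M + l w].

Let p (f : V) := inf (majorants f).

(** The domination hypothesis on [l], taken at [- w], is what keeps the infimum finite. *)
Let majorants_ge (f : V) N r : (forall t, - N <= f t) -> majorants f r -> - (m * N) <= r.
Proof.
move=> fN [w [M [fM ->]]]; have /lx : forall t, x (- w) t <= M + N.
  by move=> t; have := fN t; have := fM t; rewrite (scalar_funN (xs t)); lra.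
by rewrite (scalar_funN ls); lra.
Qed.

Let majorants_lb (f : V) : has_lbound (majorants f).
Proof.
have [N fN] := bounded_funP f; exists (- (m * N)) => r.
by apply: majorants_ge => t; have := fN t; rewrite ler_norml => /andP[].
Qed.

Let p_le (f : V) w M : (forall t, f t <= x w t + M) -> p f <= m * M + l w.
Proof. by move=> fM; apply: ge_inf => //; exists w, M. Qed.

Let p_ge (f : V) y : (forall w M, (forall t, f t <= x w t + M) -> y <= m * M + l w) -> y <= p f.
Proof.
move=> H; apply: lb_le_inf; last by move=> _ [w [M [fM ->]]]; exact: H.
have [N fN] := bounded_funP f; exists (m * N + l 0), 0, N; split => // t.
by rewrite (scalar_fun0 (xs t)) add0r (le_trans (ler_norm _)).
Qed.

Let p_sublinear : sublinear p.
Proof.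
have pZ a (f : V) : 0 < a -> p (a *: f) <= a * p f.
  move=> a0; rewrite -ler_pdivrMl //; apply: p_ge => w M fM.
  rewrite ler_pdivrMl // mulrDr -(scalar_funZ ls) mulrCA; apply: p_le => t.
  by rewrite (scalar_funZ (xs t)) -mulrDr -[(a *: f) t]/(a * f t) ler_pM2l.
split=> [f g|a f a0].
  rewrite -lerBlDr; apply: p_ge => w M fM; rewrite lerBlDr [leRHS]addrC -lerBlDr.
  apply: p_ge => w' M' gM; rewrite lerBlDr.
  have -> : m * M' + l w' + (m * M + l w) = m * (M + M') + l (w + w').
    by rewrite (scalar_funD ls); ring.
  apply: p_le => t; rewrite (scalar_funD (xs t)).
  by have := fM t; have := gM t; rewrite -[(f + g) t]/(f t + g t); lra.
apply/eqP; rewrite eq_le pZ //= -ler_pdivlMl //.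
by have := @pZ a^-1 (a *: f); rewrite invr_gt0 scalerA mulVf ?gt_eqF// scale1r; exact.
Qed.

Lemma mean_extension : exists L : (T -> R) -> R,
  [/\ forall a f g, is_bounded f -> is_bounded g -> L (a *: f + g) = a * L f + L g,
      forall f M, is_bounded f -> (forall t, f t <= M) -> L f <= m * M
    & forall w, L (x w) = l w].
Proof.
(* Every linear functional below [p] extends [l], because [p] is at most [l w] at [x w] and at most
   [- l w] at [- x w]; no value needs to be attained, so the base point is [0]. *)
have [L0 [L0s L0p _]] := hahn_banach 0 p_sublinear.
have xb' w : x w \in @bounded_pred R T by exact/asboolP.
(* Functions that are not bounded are sent to [L0 0] by [insubd]; the properties claimed concern
   bounded functions only. *)
exists (fun f => L0 (insubd 0 f)); split => [a f g fb gb|f M fb fM|w].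
- have fb' : f \in @bounded_pred R T by exact/asboolP.
  have gb' : g \in @bounded_pred R T by exact/asboolP.
  have fgb : a *: f + g \in @bounded_pred R T by rewrite rpredD // rpredZ.
  rewrite -L0s; congr L0; apply: val_inj.
  by rewrite /= !insubdK.
- have fb' : f \in @bounded_pred R T by exact/asboolP.
  apply: (le_trans (L0p _)).
  have := @p_le (insubd 0 f) 0 M; rewrite (scalar_fun0 ls) addr0; apply => t.
  by rewrite (scalar_fun0 (xs t)) add0r (insubdK _ fb').
- apply/eqP; rewrite eq_le; apply/andP; split.
    have := @p_le (insubd 0 (x w)) w 0; rewrite mulr0 add0r => h.
    by apply: (le_trans (L0p _)); apply: h => t; rewrite addr0 (insubdK _ (xb' w)).
  rewrite -lerN2 -(scalar_funN L0s) -(scalar_funN ls).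
  have := @p_le (- insubd 0 (x w)) (- w) 0; rewrite mulr0 add0r => h.
  apply: (le_trans (L0p _)); apply: h => t.
  by rewrite addr0 (scalar_funN (xs t)) /= (insubdK _ (xb' w)).
Qed.

End mean.

(** * Finitely additive set functions realized on the line *)

Section realization.
Context {R : realType} {T : Type}.
Variable P : set T -> R.
Hypotheses (P_ge0 : forall A, 0 <= P A)
  (P_split : forall A E, P A = P (A `&` E) + P (A `\` E)).

(* The bits of t are obtained by successively cutting the interval
   [a, a + P D[ in proportion to the masses of the pieces of D. *)
Fixpoint bit_set (E : nat -> set T) (n : nat) (a : R) (D : set T) : set R :=
  if n is n'.+1 then
    bit_set (E \o succn) n' a (D `&` E 0) `|`
    bit_set (E \o succn) n' (a + P (D `&` E 0)) (D `\` E 0)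
  else `[a, a + P (D `&` E 0)[%classic.

Lemma bit_set_sub E n a D : bit_set E n a D `<=` `[a, a + P D[.
Proof.
elim: n E a D => [|n IH] E a D t /=; rewrite (P_split D (E 0)) /=.
  rewrite !in_itv /= => /andP[-> /lt_le_trans]; apply.
  by rewrite lerD2l lerDl.
have := P_ge0 (D `&` E 0); have := P_ge0 (D `\` E 0).
by move=> p1 p2 [] /IH /=; rewrite !in_itv /=; lra.
Qed.

Lemma measurable_bit_set E n a D :
  measurable (bit_set E n a D : set (measurableTypeR R)).
Proof.
elim: n E a D => [|n IH] E a D /=; first exact: measurable_itv.
by apply: measurableU; exact: IH.
Qed.

Lemma lebesgue_measure_bit_set E n a D :
  lebesgue_measure (bit_set E n a D) = (P (D `&` E n))%:E.
Proof.
elim: n E a D => [|n IH] E a D /=.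
  rewrite lebesgue_measure_itv /= lte_fin ltrDl; case: ltP => [_|].
    by rewrite -EFinB addrAC subrr add0r.
  by move=> p0; congr EFin; apply/eqP; rewrite eq_le p0 P_ge0.
rewrite measureU /=; [|exact: measurable_bit_set|exact: measurable_bit_set|].
  rewrite !IH /= -EFinD (P_split (D `&` E n.+1) (E 0)); congr (P _ + P _)%:E.
    by rewrite setIAC.
  by rewrite !setDE setIAC.
apply/seteqP; split => // t /= [/bit_set_sub + /bit_set_sub] /=.
rewrite !in_itv /= => /andP[_ ta] /andP[at_ _].
by move: (lt_le_trans ta at_); rewrite ltxx.
Qed.

(** A point of the interval lies in a cell of positive length, so the piece of [D] behind it has
    positive mass and is nonempty. Only finitely many bits are matched at once: under finite
    additivity alone, an infinite intersection of pieces may be empty. *)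
Lemma bit_set_cell E n a D t : `[a, a + P D[%classic t ->
  exists2 b, D b & forall j, (j < n)%N -> E j b <-> bit_set E j a D t.
Proof.
elim: n E a D => [|n IH] E a D.
  rewrite /= in_itv /= => tD; have [[b Db]|D0] := pselect (D !=set0); first by exists b.
  have {}D0 : D = set0 by apply/seteqP; split => // b Db; case: D0; exists b.
  by have := P_split set0 set0; rewrite setI0 setD0 -D0; lra.
rewrite /= (P_split D (E 0)) in_itv /= => tD.
have [t0|t0] := ltP t (a + P (D `&` E 0)).
  have [|b [Db E0b] bP] := IH (E \o succn) a (D `&` E 0).
    by rewrite /= in_itv /= t0 (andP tD).1.
  exists b => // -[_|j] /=; first by rewrite in_itv /= t0 (andP tD).1.
  rewrite ltnS => /bP bj; split=> [/bj|]; first by left.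
  by move=> [/bj //|/bit_set_sub]; rewrite /= in_itv /=; lra.
have [|b [Db E0b] bP] := IH (E \o succn) (a + P (D `&` E 0)) (D `\` E 0).
  by rewrite /= in_itv /= t0 -addrA (andP tD).2.
exists b => // -[_|j] /=; first by rewrite in_itv /= ltNge t0 /= andbF.
rewrite ltnS => /bP bj; split=> [/bj|]; first by right.
by move=> [/bit_set_sub|/bj //]; rewrite /= in_itv /=; lra.
Qed.

End realization.

Lemma measure_realization {R : realType} {T : Type} (b0 : T) (P : set T -> R)
    (E : nat -> set T) :
  (forall A, 0 <= P A) -> (forall A B, P A = P (A `&` B) + P (A `\` B)) ->
  exists (mu : {finite_measure set (measurableTypeR R) -> \bar R})
         (S : nat -> set (measurableTypeR R)),
    [/\ mu setT = (P setT)%:E,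
        forall n, measurable (S n),
        forall n, mu (S n) = (P (E n))%:E
      & forall t n, exists b, forall j, (j < n)%N -> E j b <-> S j t].
Proof.
move=> P_ge0 P_split; pose D : set (measurableTypeR R) := `[0, 0 + P setT[%classic.
have mD : measurable D by exact: measurable_itv.
have muD : lebesgue_measure D = (P setT)%:E.
  rewrite lebesgue_measure_itv /= lte_fin ltrDl; case: ltP => [_|p0].
    by rewrite -EFinB addrAC subrr add0r.
  by congr EFin; apply/eqP; rewrite eq_le p0 P_ge0.
have muDoo : (lebesgue_measure D < +oo)%E by rewrite muD ltry.
pose S0 n : set (measurableTypeR R) := bit_set P E n 0 setT.
have S0D n : S0 n `<=` D by exact: bit_set_sub.
(* Off D every point gets the bits of b0. *)
pose S n := S0 n `|` (if `[< E n b0 >] then ~` D else set0).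
have SD n : S n `&` D = S0 n.
  rewrite setIUl (setIidl (S0D n)); case: asboolP => _; last by rewrite set0I setU0.
  by rewrite setICl setU0.
exists (mfrestr mD muDoo), S; split => [|n|n|t n].
- by rewrite -muD -[in RHS](setTI D).
- apply: measurableU; first exact: measurable_bit_set.
  by case: asboolP => _; [exact: measurableC|exact: measurable0].
- rewrite -[LHS]/(lebesgue_measure (S n `&` D)) SD.
  by rewrite lebesgue_measure_bit_set // setTI.
- have [Dt|Dt] := pselect (D t).
    have [b _ bE] := bit_set_cell P_ge0 P_split E n Dt; exists b => j /bE ->.
    split=> [|[//|]]; first by left.
    by case: asboolP.
  exists b0 => j _; split=> [Eb|[/S0D //|]]; first by right; rewrite asboolT.
  by case: asboolP.
Qed.

(** * Comparison of means by step functions *)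

Section grid.
Context {R : realType}.

(** The sum counts the multiples of [h] that do not exceed [y]. The count starts at [k = 0], so it
    overshoots [y / h] by at most one. At equality the bit may take either value. *)
Lemma grid_sum_bounds (y h : R) (e : nat -> bool) (K : nat) : 0 < h -> 0 <= y ->
  (forall k, e k -> h *+ k <= y) -> (forall k, ~~ e k -> y <= h *+ k) ->
  y <= h *+ K -> y <= h * (\sum_(k < K) (e k)%:R) <= y + h.
Proof.
move=> h0 y0 e1 e0 yK.
(* Truncating [y] at the height reached so far gives a statement that holds for every [K] and passes
   through the induction. *)
suff : Num.min y (h *+ K) <= h * (\sum_(k < K) (e k)%:R) <= Num.min y (h *+ K) + h.
  by rewrite min_l.
elim: K {yK} => [|K /andP[IH1 IH2]].
  by rewrite big_ord0 mulr0 mulr0n min_r // lexx add0r ltW.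
rewrite big_ord_recr /=.
have sumK : h * (\sum_(k < K) (e k)%:R) <= h *+ K.
  rewrite -mulr_natr ler_pM2l //; apply: (@le_trans _ _ (\sum_(k < K) 1)).
    by apply: ler_sum => k _; case: (e k).
  by rewrite sumr_const card_ord.
have [eK|eK] := boolP (e K); rewrite /= mulrDr ?mulr1 ?mulr0 ?addr0.
  have := e1 _ eK => Ky; move: IH1 IH2; rewrite min_r // mulrSr => IH1 IH2.
  by rewrite !minEle; case: ifP; lra.
have := e0 _ eK => Ky; move: IH1 IH2; rewrite min_l // mulrSr => IH1 IH2.
by rewrite min_l ?IH1 //; lra.
Qed.

Section mean_on.
Context {T : Type}.
Variables (Q : set (T -> R)) (L : (T -> R) -> R) (m : R).

(** The class [Q] is a parameter because the mean to be represented lives on all bounded functions,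
    while the integral that represents it lives on the measurable bounded ones. Both are handled by
    the same estimate. *)
Definition mean_on := [/\ forall c, Q (cst c),
  forall a f g, Q f -> Q g -> Q (a *: f + g),
  forall a f g, Q f -> Q g -> L (a *: f + g) = a * L f + L g
  & forall f M, Q f -> (forall t, f t <= M) -> L f <= m * M].

Hypothesis QL : mean_on.

Lemma mean_on_cst c : L (cst c) = m * c.
Proof.
have [Q1 QD LD Lm] := QL.
have Lc c' : L (cst c') <= m * c' by exact: Lm.
apply/eqP; rewrite eq_le Lc /=.
have L0 : L (cst 0) = 0.
  have := LD 1 _ _ (Q1 0) (Q1 0); rewrite mul1r.
  have -> : 1 *: cst 0 + cst 0 = cst 0 :> (T -> R).
    by apply/funext => t; rewrite /= !fctE /= scaler0 addr0.
  by lra.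
have := LD (-1) _ _ (Q1 c) (Q1 0); rewrite L0.
have -> : (-1) *: cst c + cst 0 = cst (- c) :> (T -> R).
  by apply/funext => t; rewrite /= !fctE /= addr0 scaleN1r.
by have := Lc (- c); lra.
Qed.

Lemma mean_on_le f g : Q f -> Q g -> (forall t, f t <= g t) -> L f <= L g.
Proof.
have [Q1 QD LD Lm] := QL => Qf Qg fg.
have := LD (-1) _ _ Qg Qf; have := Lm _ 0 (QD (-1) _ _ Qg Qf).
rewrite mulr0 => h1 h2; have : L (- 1 *: g + f) <= 0.
  by apply: h1 => t; rewrite !fctE /= scaleN1r; have := fg t; lra.
by lra.
Qed.

Lemma mean_on_sum (F : nat -> T -> R) (h : R) K : (forall k, Q (F k)) ->
  Q (fun t => h * \sum_(k < K) F k t) /\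
  L (fun t => h * \sum_(k < K) F k t) = h * \sum_(k < K) L (F k).
Proof.
have [Q1 QD LD Lm] := QL => QF.
elim: K => [|K [IH1 IH2]].
  under eq_fun do rewrite big_ord0 mulr0.
  rewrite big_ord0 mulr0; split; first exact: (Q1 0).
  by rewrite -[RHS](mulr0 m); exact: (mean_on_cst 0).
have -> : (fun t => h * \sum_(k < K.+1) F k t) =
          h *: F K + (fun t => h * \sum_(k < K) F k t).
  by apply/funext => t; rewrite big_ord_recr /= mulrDr addrC.
split; first exact: QD.
by rewrite LD // IH2 big_ord_recr /= mulrDr addrC.
Qed.

(** The central value involves [L] only through indicators of the [A k]. Two means of mass [m],
    possibly on different spaces, whose indicators have equal values therefore give results within
    [2 * m * h] of each other. *)
Lemma mean_on_grid (x : T -> R) (M h : R) (A : nat -> set T) K : 0 < h ->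
  Q x -> (forall k, Q (\1_(A k))) -> (forall t, - M <= x t) ->
  (forall k t, A k t -> - M + h *+ k <= x t) ->
  (forall k t, ~ A k t -> x t <= - M + h *+ k) ->
  (forall t, x t <= - M + h *+ K) ->
  `|L x - (h * \sum_(k < K) L (\1_(A k)) - m * M)| <= m * h.
Proof.
have [Q1 QD LD Lm] := QL.
move=> h0 Qx QA xM A1 A0 xK.
have [Qs Ls] := mean_on_sum h K QA.
rewrite -Ls; set s := (fun t => h * _) in Qs Ls *.
have sx t : x t + M <= s t <= x t + M + h.
  have -> : s t = h * \sum_(k < K) (`[< A k t >])%:R.
    by rewrite /s; congr *%R; apply: eq_bigr => k _; rewrite indicE in_setE.
  apply: (grid_sum_bounds (e := fun k => `[< A k t >])) => //.
  - by have := xM t; lra.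
  - by move=> k /asboolP /A1; lra.
  - by move=> k /asboolPn /A0; lra.
  - by have := xK t; lra.
have h1 : L x + m * M <= L s.
  rewrite -(mean_on_cst M) -[L x]mul1r -LD //; apply: mean_on_le => // [|t].
    exact: QD.
  by rewrite !fctE /= scale1r; have := sx t; lra.
have h2 : L s <= L x + m * (M + h).
  rewrite -(mean_on_cst (M + h)) -[L x]mul1r -LD //; apply: mean_on_le => // [|t].
    exact: QD.
  by rewrite !fctE /= scale1r; have := sx t; lra.
by rewrite ler_norml; lra.
Qed.

End mean_on.
End grid.

Section countable_operations.
Context d (T : measurableType d) (U : countType).
Implicit Types (P : set U) (F : U -> set T).

Lemma countable_bigcup_measurable P F :
  (forall u, P u -> measurable (F u)) -> measurable (\bigcup_(u in P) F u).
Proof.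
move=> mF; rewrite bigcup_mkcond; apply: countable_bigcupT_measurable => // u.
by case: ifPn => [/[!inE]/mF|].
Qed.

Lemma countable_bigcap_measurable P F :
  (forall u, P u -> measurable (F u)) -> measurable (\bigcap_(u in P) F u).
Proof.
move=> mF; rewrite -[X in measurable X]setCK setC_bigcap; apply: measurableC.
by apply: countable_bigcup_measurable => u Pu; exact/measurableC/mF.
Qed.

End countable_operations.

Section sequence_limits.
Context {R : realType}.

Lemma cvg_seq_ge (u : nat -> R) l c N : u @ \oo --> l ->
  (forall j, (N <= j)%N -> c <= u j) -> c <= l.
Proof.
move=> ul cu; apply: (ler_cvg_to (cvg_cst c) ul).
by near=> j; apply: cu; near: j; exact: nbhs_infty_ge.
Unshelve. all: by end_near. Qed.

Lemma cvg_seq_le (u : nat -> R) l c N : u @ \oo --> l ->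
  (forall j, (N <= j)%N -> u j <= c) -> l <= c.
Proof.
move=> ul cu; apply: (ler_cvg_to ul (cvg_cst c)).
by near=> j; apply: cu; near: j; exact: nbhs_infty_ge.
Unshelve. all: by end_near. Qed.

End sequence_limits.

Section representation.
Context {R : realType} {T : Type} {I : countType}.
Variables (b0 : T) (x : I -> T -> R) (L : (T -> R) -> R) (m : R).

(** Sequential compactness as seen by the coordinates [x i]. The bound [j <= phi j] stands in for a
    strictly increasing extraction; it is all that limits require. *)
Definition coordinate_compact := forall b : nat -> T, exists phi : nat -> nat,
  (forall j, (j <= phi j)%N) /\
  exists b', forall i, x i (b (phi j)) @[j --> \oo] --> x i b'.

Hypotheses (xb : forall i, is_bounded (x i))
  (Lmean : mean_on (@is_bounded R T) L m) (xcompact : coordinate_compact).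

Let P (A : set T) : R := L (\1_A).

Let indic_bounded (A : set T) : is_bounded (\1_A : T -> R).
Proof. by exists 1 => t; rewrite indicE; case: (_ \in _); rewrite ?normr1 ?normr0. Qed.

Let P_ge0 A : 0 <= P A.
Proof.
rewrite -[leLHS](mulr0 m) -(mean_on_cst Lmean); apply: (mean_on_le Lmean).
- by exists 0 => t; rewrite normr0.
- exact: indic_bounded.
- by move=> t; rewrite indicE.
Qed.

Let P_split A B : P A = P (A `&` B) + P (A `\` B).
Proof.
have [_ _ LD _] := Lmean.
have := LD 1 _ _ (indic_bounded (A `&` B)) (indic_bounded (A `\` B)).
rewrite mul1r => <-; congr L; apply/funext => t.
rewrite !fctE /= scale1r !indicE in_setI in_setD.
by case: (t \in A); case: (t \in B); rewrite /= ?addr0 ?add0r.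
Qed.

Let threshold n : set T :=
  if @unpickle (I * rat)%type n is Some (i, q) then [set t | ratr q <= x i t] else set0.

Let bit (i : I) (q : rat) := pickle (i, q).

Let thresholdE i q t : threshold (bit i q) t = (ratr q <= x i t) :> Prop.
Proof. by rewrite /threshold /bit pickleK. Qed.

Lemma mean_on_integral d (U : measurableType d) (mu : {finite_measure set U -> \bar R}) :
  mean_on [set f : U -> R | measurable_fun setT f /\ is_bounded f]
    (fun f => \int[mu]_t f t) (fine (mu setT)).
Proof.
have fint f : measurable_fun setT f /\ is_bounded f -> mu.-integrable setT (EFin \o f).
  move=> [mf [M fM]]; apply: measurable_bounded_integrable => //.
    by rewrite ltey_eq fin_num_measure.
  by exists M; split; [exact: num_real|move=> N MN t _ /=; exact: le_trans (fM t) (ltW MN)].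
split=> [c|a f g [mf [M fM]] [mg [N gN]]|a f g Qf Qg|f M Qf fM].
- by split=> //; exists `|c|.
- split; first by apply: measurable_funD => //; exact: measurable_funM.
  exists (`|a| * M + N) => t; apply: (le_trans (ler_normD _ _)).
  by apply: lerD => //; rewrite normrM ler_wpM2l.
- have Qaf : mu.-integrable setT (EFin \o (fun t => a * f t)).
    apply: fint; split; first exact: measurable_funM Qf.1.
    have [M fM] := Qf.2; exists (`|a| * M) => t.
    by rewrite normrM ler_wpM2l.
  by rewrite RintegralD ?RintegralZl //; exact: fint.
- rewrite mulrC -Rintegral_cst //; apply: le_Rintegral => //; first exact: fint.
  by apply: fint; split => //; exists `|M|.
Qed.

(* The thresholds [ratr q <= x i] are realized as subsets of the line by
   measure_realization. Every t on the line has, for each n, a point of T with the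
   same first n bits; beta t is a limit of these points. *)
Theorem mean_representation :
  exists (mu : {finite_measure set (measurableTypeR R) -> \bar R})
         (beta : measurableTypeR R -> T),
    [/\ mu setT = m%:E, forall i, measurable_fun setT (x i \o beta)
      & forall i, \int[mu]_t x i (beta t) = L (x i)].
Proof.
have [mu [S [muT mS muS cell]]] := measure_realization b0 threshold P_ge0 P_split.
have PT : P setT = m.
  by rewrite -[RHS]mulr1 -(mean_on_cst Lmean); congr L; apply/funext => t; rewrite indicE in_setT.
have limit t : exists b, forall i q,
    (S (bit i q) t -> ratr q <= x i b) /\ (~ S (bit i q) t -> x i b <= ratr q).
  have [b bS] := choice (cell t); have [phi [phij [b' bb']]] := xcompact b.
  exists b' => i q.
  have H j : (bit i q < j)%N -> S (bit i q) t <-> ratr q <= x i (b (phi j)).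
    by move=> qj; rewrite -(bS (phi j) (bit i q) (leq_trans qj (phij j))) thresholdE.
  split=> Sq.
    by apply: (@cvg_seq_ge _ _ _ _ (bit i q).+1 (bb' i)) => j /H[+ _]; exact.
  apply: (@cvg_seq_le _ _ _ _ (bit i q).+1 (bb' i)) => j /H[_ H'].
  by rewrite leNgt; apply/negP => /ltW /H'.
have [beta betaS] := choice limit.
(* Passing to the limit leaves only non-strict inequalities on both sides of a bit; a rational
   strictly between [r] and the value of [x i] removes the ambiguity. *)
have mx i : measurable_fun setT (x i \o beta).
  apply: (measurability _ (RGenOInfty.measurableE R)) => //.
  move=> _ [_ [r ->] <-]; rewrite setTI.
  have -> : (x i \o beta) @^-1` `]r, +oo[ =
      \bigcup_(q in [set q : rat | r < ratr q]) S (bit i q).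
    apply/seteqP; split=> t /=.
      rewrite in_itv /= andbT => rx; have [q /[!in_itv]/andP[/= rq qx]] := rat_in_itvoo rx.
      exists q => //; apply: contrapT => /(betaS t i q).2 /=.
      by rewrite leNgt qx.
    by move=> [q /= rq /(betaS t i q).1 qx]; rewrite in_itv /= andbT (lt_le_trans rq).
  by apply: countable_bigcup_measurable => q _; exact: mS.
exists mu, beta; split => // [|i]; first by rewrite muT PT.
have m0 : 0 <= m by rewrite -PT; exact: P_ge0.
have [M0 xM0] := xb i.
pose N := (Num.truncn M0).+1.
have xN t : `|x i t| <= N%:R.
  by apply: le_trans (xM0 t) _; apply/ltW/truncnS_gt.
have muE : mean_on [set f : measurableTypeR R -> R | measurable_fun setT f /\ is_bounded f]
    (fun f => \int[mu]_t f t) m.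
  by have := mean_on_integral mu; rewrite muT PT.
apply/eqP; rewrite -subr_eq0 -normr_le0; apply/ler_addgt0Pr => e e0; rewrite add0r.
(* The two grid estimates together cost [2 * m * h], which this [n] brings below [e]. The grid goes
   from [- N%:R] to [N%:R] in [K] steps of length [h], and its points are rational, hence
   thresholds. *)
pose n := Num.truncn (2 * (m + 1) / e).
pose hq : rat := n.+1%:R^-1.
pose h : R := n.+1%:R^-1.
have h0 : 0 < h by rewrite invr_gt0.
pose q k : rat := - N%:R + hq *+ k.
have qE k : ratr (q k) = - N%:R + h *+ k :> R.
  by rewrite /q /hq rmorphD rmorphN !rmorphMn rmorph1 fmorphV rmorph_nat.
pose K := (n.+1 * (2 * N))%N.
have hK : - N%:R + h *+ K = N%:R :> R.
  rewrite /K mulrnA -[h *+ _]mulr_natr /h mulVf ?pnatr_eq0 // natrM.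
  by lra.
have := mean_on_grid (K := K) Lmean (x := x i) (M := N%:R) h0 (xb i)
  (fun k => indic_bounded (threshold (bit i (q k)))).
set s := h * _ => h1; have {}h1 : `|L (x i) - (s - m * N%:R)| <= m * h.
  apply: h1 => [t|k t|k t|t].
  - by have := xN t; rewrite ler_norml => /andP[].
  - by rewrite thresholdE qE.
  - by rewrite thresholdE qE => /negP; rewrite -ltNge => /ltW.
  - by rewrite hK; have := xN t; rewrite ler_norml => /andP[].
have := mean_on_grid (K := K) muE (x := x i \o beta) (M := N%:R) (A := fun k => S (bit i (q k))) h0.
have -> : \sum_(k < K) \int[mu]_t \1_(S (bit i (q k))) t =
          \sum_(k < K) L (\1_(threshold (bit i (q k)))).
  apply: eq_bigr => k _; rewrite /Rintegral integral_indic // setIT.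
  exact: (congr1 fine (muS _)).
rewrite -/s => h2; have {}h2 : `|\int[mu]_t x i (beta t) - (s - m * N%:R)| <= m * h.
  apply: h2 => [|k|t|k t|k t|t].
  - by split => //; exists N%:R => t; exact: xN.
  - split; first exact: measurable_indic.
    by exists 1 => t; rewrite indicE; case: (_ \in _); rewrite ?normr1 ?normr0.
  - by have := xN (beta t); rewrite ler_norml => /andP[].
  - by move=> /(betaS t i _).1; rewrite qE.
  - by move=> /(betaS t i _).2; rewrite qE.
  - by rewrite hK; have := xN (beta t); rewrite ler_norml => /andP[].
have he : 2 * (m * h) <= e.
  rewrite mulrA /h ler_pdivrMr //.
  by have := truncnS_gt (2 * (m + 1) / e); rewrite -/n ltr_pdivrMr // [e * _]mulrC; lra.
have := ler_distD (s - m * N%:R) (\int[mu]_t x i (beta t)) (L (x i)).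
by rewrite (distrC (s - _)); lra.
Qed.

End representation.

(** * Weak* sequential compactness *)

Section extraction.
Context {R : realType} {I : countType}.

Lemma cylinder_nbhs (y : prod_topology (fun _ : I => R)) (e : R) (j : nat) :
  0 < e -> nbhs y [set f | forall i, (pickle i < j)%N -> `|y i - f i| < e].
Proof.
move=> e0; have F := nbhs_filter y.
elim: j => [|j IH]; first exact: (@filterS _ _ F setT _ _ filterT).
have [[i ij]|noti] := pselect (exists i : I, pickle i = j).
  have yi : nbhs y [set f | `|y i - f i| < e].
    have ye : nbhs (y i : R) [set r | `|y i - r| < e].
      by apply/nbhs_normP; exists e.
    exact: (@proj_continuous I (fun=> R) i y _ ye).
  apply: (@filterS _ _ F _ _ _ (@filterI _ _ F _ _ IH yi)) => f [fj fi] i'.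
  rewrite ltnS leq_eqVlt => /orP[/eqP i'j|]; last exact: fj.
  by rewrite (pcan_inj pickleK (etrans i'j (esym ij))).
apply: (@filterS _ _ F _ _ _ IH) => f fj i; rewrite ltnS leq_eqVlt => /orP[/eqP ij|]; last exact: fj.
by case: noti; exists i.
Qed.

(** Tychonoff replaces nested subsequences: near a cluster point of the sequence in the product of
    segments, the [j]-th index is chosen beyond [j] and [1 / (j + 1)]-close on the coordinates coded
    below [j]. *)
Lemma diagonal_extraction (x : I -> nat -> R) :
  (forall i, is_bounded (x i)) -> exists phi : nat -> nat,
  (forall j, (j <= phi j)%N) /\
  exists y : I -> R, forall i, x i (phi j) @[j --> \oo] --> y i.
Proof.
move=> /choice[M xM]; pose u n : prod_topology (fun _ : I => R) := fun i => x i n.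
have cK := tychonoff (fun i => @segment_compact R (- M i) (M i)).
have uK : (u @ \oo) [set f | forall i, `[- M i, M i]%classic (f i)].
  by exists 0%N => // n _ i /=; rewrite in_itv /= -ler_norml xM.
have [y [_ yu]] := cK _ _ uK.
have near_y j : exists n, (j <= n)%N /\
    forall i, (pickle i < j)%N -> `|y i - x i n| < j.+1%:R^-1.
  have A : (u @ \oo) [set f | exists2 n, (j <= n)%N & f = u n].
    by exists j => // n /= jn; exists n.
  have [_ [[n jn ->] un]] := yu _ _ A (@cylinder_nbhs y j.+1%:R^-1 j ltac:(by rewrite invr_gt0)).
  by exists n.
have [phi phiP] := choice near_y.
exists phi; split; first by move=> j; have [] := phiP j.
exists y => i; apply/cvgrPdist_lt => e e0.
near=> j; have [_ /(_ i) H] := phiP j; apply: (lt_trans (H _)).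
  by near: j; exact: nbhs_infty_gt.
by near: j; exact: near_infty_natSinv_lt (PosNum e0).
Unshelve. all: by end_near. Qed.

End extraction.

Section weak_star_limits.
Context {R : realType} {X Xs : normedModType R} {iota : X -> Xs -> R}.
Hypothesis predualX : is_predual iota.
Variable z : nat -> Xs.
Hypothesis zdense : qdense z.

Let small (u K : R) : 0 <= K -> (forall e, 0 < e -> `|u| <= K * e) -> u = 0.
Proof.
move=> K0 H; apply/eqP; rewrite -normr_le0; apply/ler_addgt0Pr => e e0; rewrite add0r.
have K1 : 0 < K + 1 by lra.
apply: (le_trans (H (e / (K + 1)) (divr_gt0 e0 K1))).
by rewrite mulrCA ler_piMr ?(ltW e0)// ler_pdivrMr // mul1r; lra.
Qed.

(* The McShane-type extension [w |-> inf_l (a l + C `|w - qspan z l|)] of a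
   is Lipschitz, hence linear since a is Q-linear. *)
Lemma qspan_extension (a : seq (rat * nat) -> R) (C : R) : 0 <= C ->
  (forall k l, a (k ++ l) = a k + a l) ->
  (forall q l, a (qscale q l) = ratr q * a l) ->
  (forall l, a l <= C * `|qspan z l|) ->
  exists v, forall l, iota v (qspan z l) = a l.
Proof.
move=> C0 aD aZ aC.
have aB k l : a k - a l <= C * `|qspan z k - qspan z l|.
  have := aC (k ++ qscale (-1) l).
  by rewrite aD aZ qspan_cat qspan_scale rmorphN rmorph1 mulN1r scaleN1r.
pose phi w := inf [set a l + C * `|w - qspan z l| | l in [set: seq (rat * nat)]].
have lbd w k : lbound [set a l + C * `|w - qspan z l| | l in [set: seq (rat * nat)]]
    (a k - C * `|w - qspan z k|).
  move=> _ [l _ <-]; have := aB k l.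
  have : C * `|qspan z k - qspan z l| <= C * (`|w - qspan z k| + `|w - qspan z l|).
    by rewrite ler_wpM2l // (distrC w (qspan z k)) ler_distD.
  by lra.
have phia w l : `|phi w - a l| <= C * `|w - qspan z l|.
  have h1 : phi w <= a l + C * `|w - qspan z l|.
    by apply: ge_inf; [exists (a l - C * `|w - qspan z l|); exact: lbd|exists l].
  have h2 : a l - C * `|w - qspan z l| <= phi w.
    by apply: lb_le_inf; [exists (a l + C * `|w - qspan z l|), l|exact: lbd].
  by rewrite ler_norml; lra.
have phiE l : phi (qspan z l) = a l.
  by apply/eqP; rewrite -subr_eq0 -normr_le0 (le_trans (phia _ l)) // subrr normr0 mulr0.
have a0 : a [::] = 0 by have := aD [::] [::]; rewrite /=; lra.
have phi_le w : `|phi w| <= C * `|w|.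
  by have := phia w [::]; rewrite a0 qspan_nil !subr0.
have phiD w w' : phi (w + w') = phi w + phi w'.
  apply/eqP; rewrite -subr_eq0; apply/eqP; apply: (@small _ (4 * C)); first lra.
  move=> e e0; have [l wl] := zdense w e0; have [l' wl'] := zdense w' e0.
  have := phia (w + w') (l ++ l'); have := phia w l; have := phia w' l'.
  rewrite aD qspan_cat; have -> : w + w' - (qspan z l + qspan z l') =
    (w - qspan z l) + (w' - qspan z l') by rewrite opprD addrACA.
  have := ler_wpM2l C0 (ler_normD (w - qspan z l) (w' - qspan z l')).
  have := ler_wpM2l C0 (ltW wl); have := ler_wpM2l C0 (ltW wl').
  by rewrite mulrDr; rewrite !ler_norml; lra.
have phiN w : phi (- w) = - phi w.
  by have := phiD w (- w); rewrite subrr -(qspan_nil z) phiE a0; lra.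
have phiQ (q : rat) w : phi (ratr q *: w) = ratr q * phi w.
  apply/eqP; rewrite -subr_eq0; apply/eqP.
  apply: (@small _ (2 * (C * `|ratr q|))); first by rewrite !mulr_ge0.
  move=> e e0; have [l wl] := zdense w e0.
  have := phia (ratr q *: w) (qscale q l); rewrite aZ qspan_scale -scalerBr normrZ.
  have := phia w l.
  have -> : phi (ratr q *: w) - ratr q * phi w =
    (phi (ratr q *: w) - ratr q * a l) - ratr q * (phi w - a l) by ring.
  move=> h1 h2; apply: (le_trans (ler_normB _ _)); rewrite [X in _ + X]normrM.
  have := ler_wpM2l (normr_ge0 (ratr q : R)) h1.
  have := ler_wpM2l (mulr_ge0 C0 (normr_ge0 (ratr q : R))) (ltW wl).
  by lra.
have phis : scalar phi.
  move=> b w w'; rewrite phiD; congr (_ + _).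
  apply/eqP; rewrite -subr_eq0; apply/eqP.
  apply: (@small _ (2 * (C * `|w|))); first by rewrite !mulr_ge0.
  move=> e e0.
  have [r /[!in_itv]/andP[/= br rb]] := @rat_in_itvoo R b (b + e) ltac:(lra).
  have -> : phi (b *: w) - b * phi w = phi ((b - ratr r) *: w) - (b - ratr r) * phi w.
    by rewrite scalerBl phiD phiN phiQ; ring.
  apply: (le_trans (ler_normB _ _)); rewrite normrM.
  have be : `|b - ratr r| <= e by rewrite ler_norml; lra.
  have := phi_le ((b - ratr r) *: w); rewrite normrZ => h1.
  have := ler_pM (normr_ge0 _) (normr_ge0 _) be (phi_le w).
  have := ler_wpM2l (mulr_ge0 C0 (normr_ge0 w)) be.
  by lra.
have [v vphi] := dual_representation predualX phis phi_le.
by exists v => l; rewrite vphi phiE.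
Qed.

Lemma weak_star_cvg_qspan (v : nat -> X) v' (M : R) : (forall n, `|v n| <= M) ->
  (forall l, iota (v n) (qspan z l) @[n --> \oo] --> iota v' (qspan z l)) ->
  forall w, iota (v n) w @[n --> \oo] --> iota v' w.
Proof.
move=> vM vl w; apply/cvgrPdist_lt => e e0.
have M0 : 0 <= M by exact: le_trans (normr_ge0 _) (vM 0).
have D0 : 0 < `|v'| + M + 1 by have := normr_ge0 v'; lra.
have [l wl] := @zdense w (e / 2 / (`|v'| + M + 1)) ltac:(by rewrite !divr_gt0).
have e2 : 0 < e / 2 by rewrite divr_gt0.
have /cvgrPdist_lt/(_ _ e2) vle := vl l.
near=> n.
have : `|iota v' (qspan z l) - iota (v n) (qspan z l)| < e / 2.
  by near: n; exact: vle.
have -> : iota v' w - iota (v n) w =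
  (iota v' (qspan z l) - iota (v n) (qspan z l)) +
  (iota v' (w - qspan z l) - iota (v n) (w - qspan z l)).
  by rewrite !(scalar_funB (pairing_scalar predualX _)); ring.
have := pairing_le predualX v' (w - qspan z l).
have := pairing_le predualX (v n) (w - qspan z l).
have := ler_wpM2r (normr_ge0 (w - qspan z l)) (vM n).
have : (`|v'| + M + 1) * `|w - qspan z l| <= e / 2.
  by rewrite mulrC -ler_pdivlMr // ltW.
move=> h1 h2 h3 h4 h5.
apply: (le_lt_trans (ler_normD _ _)).
have := ler_normB (iota v' (w - qspan z l)) (iota (v n) (w - qspan z l)).
by have := normr_ge0 (w - qspan z l); nra.
Unshelve. all: by end_near. Qed.

(** Sequential Banach-Alaoglu: the limits of the pairings with the [qspan z l] are Q-linear and
    bounded by [M] times the norm, so they come from a vector. The scalar family [x] carries along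
    the entries of points of [S], or masses, under the same extraction. *)
Lemma weak_star_extraction (I : countType) (v : nat -> X) (M : R) (x : I -> nat -> R) :
  (forall n, `|v n| <= M) -> (forall i, is_bounded (x i)) ->
  exists phi : nat -> nat, exists v' : X, exists y : I -> R,
  [/\ forall j, (j <= phi j)%N, forall w, iota (v (phi j)) w @[j --> \oo] --> iota v' w
    & forall i, x i (phi j) @[j --> \oo] --> y i].
Proof.
move=> vM xb.
have M0 : 0 <= M by exact: le_trans (normr_ge0 _) (vM 0).
pose c (s : (seq (rat * nat) + I)%type) n :=
  match s with inl l => iota (v n) (qspan z l) | inr i => x i n end.
have cl l n : `|c (inl l) n| <= M * `|qspan z l|.
  by rewrite (le_trans (pairing_le predualX _ _)) // ler_wpM2r.
have [[l|i]|phi [phij [y cy]]] := @diagonal_extraction R _ c.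
- by exists (M * `|qspan z l|) => n; exact: cl.
- exact: xb.
have yE l (u : R) : c (inl l) (phi j) @[j --> \oo] --> u -> y (inl l) = u.
  exact: cvg_unique (cy (inl l)).
have [k l|q l|l|v' v'E] := @qspan_extension (fun l => y (inl l)) M M0.
- apply: yE; rewrite /c; under eq_fun do rewrite qspan_cat (scalar_funD (pairing_scalar predualX _)).
  exact: cvgD (cy (inl k)) (cy (inl l)).
- apply: yE; rewrite /c; under eq_fun do rewrite qspan_scale (scalar_funZ (pairing_scalar predualX _)).
  exact: cvgMr (cy (inl l)).
- apply: (@cvg_seq_le _ _ _ _ 0 (cy (inl l))) => j _.
  exact: le_trans (ler_norm _) (cl l _).
exists phi, v', (fun i => y (inr i)); split => [//| |i]; last exact: cy (inr i).
apply: (@weak_star_cvg_qspan (v \o phi) v' M) => [n|l]; first exact: vM.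
by rewrite v'E; exact: cy (inl l).
Qed.

End weak_star_limits.

Section weak_topologies.
Context {R : realType}.

Lemma cvg_initial_topology (S : choiceType) (T : topologicalType) (f : S -> T)
    (F : set_system S) (s : S) : Filter F ->
  f @ F --> f s -> F --> (s : initial_topology f).
Proof.
move=> FF fF A [_ [[B Bop <-] Bfs sBA]].
by apply: filterS sBA _; apply: fF; apply: open_nbhs_nbhs.
Qed.

Lemma weak_star_cvg (X Xs : normedModType R) (iota : X -> Xs -> R) (v : nat -> X) v' :
  (forall w, iota (v n) w @[n --> \oo] --> iota v' w) ->
  (v : nat -> weak_star iota) @ \oo --> (v' : weak_star iota).
Proof.
move=> vw; apply: cvg_initial_topology.
exact/(@pointwise_cvgP _ _ (iota \o v @ \oo) (iota v')).
Qed.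

Lemma weak_star_to_weak_cvg (X Xs Y : normedModType R) (iota : X -> Xs -> R)
    (A : X -> Y) (v : nat -> X) v' (phi : Y -> R) :
  weak_star_to_weak_continuous iota A -> topological_dual phi ->
  (forall w, iota (v n) w @[n --> \oo] --> iota v' w) ->
  phi (A (v n)) @[n --> \oo] --> phi (A v').
Proof.
move=> Ac dphi /weak_star_cvg vv'.
pose p : set_type (@topological_dual R Y) := exist _ phi (mem_set dphi).
have c1 := cvg_comp _ _ vv' (Ac v').
have c2 := cvg_comp _ _ c1 (@initial_continuous _ _ _ (A v')).
exact: (cvg_comp _ _ c2 (@proj_continuous _ _ p _)).
Qed.

Lemma rV_cvg d (s : nat -> 'rV[R]_d) (s' : 'rV[R]_d) :
  (forall i, s n 0 i @[n --> \oo] --> s' 0 i) -> s @ \oo --> s'.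
Proof.
move=> ss' A [P Ps' PA].
have : \forall n \near \oo, forall j, P 0 j (s n 0 j).
  by apply: filter_forall => j; apply: ss'; exact: Ps'.
by apply: filterS => n Pn; apply: PA => i j; rewrite ord1.
Qed.

End weak_topologies.

(** * The squared norm of a Hilbert space *)

Section hilbert.
Context {R : realType} {Y : normedModType R} {ip : {dot Y for @idfun R}}.
Hypothesis ipY : is_inner_product ip.

Lemma sym_inner_sqnormD a y : `|a + y| ^+ 2 = `|a| ^+ 2 + (ip a y + ip y a) + `|y| ^+ 2.
Proof. by rewrite !ipY linearDl /= !linearDr /=; ring. Qed.

Lemma sym_inner_sqnormB a y : `|a - y| ^+ 2 = `|a| ^+ 2 - (ip a y + ip y a) + `|y| ^+ 2.
Proof. by rewrite !ipY linearBl /= !linearBr /=; ring. Qed.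

(** Continuity is read off from polarization, which expresses the symmetrized form by norms
    alone. *)
Lemma sym_inner_dual y : topological_dual (fun a => ip a y + ip y a).
Proof.
split=> [c a b|a].
  by rewrite linearPl linearPr /=; ring.
have -> : (fun a => ip a y + ip y a) = (fun a => (`|a + y| ^+ 2 - `|a - y| ^+ 2) / 2).
  by apply/funext => b; rewrite sym_inner_sqnormD sym_inner_sqnormB; field.
apply: cvgMl; under eq_fun do rewrite !expr2; rewrite !expr2.
by apply: cvgB; apply: cvgM; apply: cvg_norm; (apply: cvgD || apply: cvgB) => //; exact: cvg_cst.
Qed.

End hilbert.

(** * Conditional expectations and Borel measures *)

Section image_measure.
Context d d' {T : measurableType d} {T' : measurableType d'} {R : realType}.
Variables (mu : {finite_measure set T -> \bar R}) (f : T -> T').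

Lemma measurable_preimage A : measurable_fun setT f -> measurable A ->
  measurable (f @^-1` A).
Proof. by move=> mf mA; rewrite -[X in measurable X]setTI; exact: mf. Qed.

Definition image_measure (mf : measurable_fun setT f) (A : set T') := mu (f @^-1` A).

Hypothesis mf : measurable_fun setT f.

Let image_measure0 : image_measure mf set0 = 0%E.
Proof. by rewrite /image_measure preimage_set0 measure0. Qed.

Let image_measure_ge0 A : (0 <= image_measure mf A)%E.
Proof. exact: measure_ge0. Qed.

Let image_measure_sigma_additive : semi_sigma_additive (image_measure mf).
Proof.
move=> F mF tF mUF; rewrite /image_measure preimage_bigcup.
apply: measure_semi_sigma_additive.
- by move=> n; exact: measurable_preimage.
- apply/trivIsetP => /= i j _ _ ij; rewrite -preimage_setI.
  by move/trivIsetP : tF => /(_ _ _ _ _ ij) ->//; rewrite preimage_set0.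
- by rewrite -preimage_bigcup; exact: measurable_preimage.
Qed.

HB.instance Definition _ := isMeasure.Build _ _ _ (image_measure mf)
  image_measure0 image_measure_ge0 image_measure_sigma_additive.

Let image_measure_finite : fin_num_fun (image_measure mf).
Proof. by move=> A mA; apply: fin_num_measure; exact: measurable_preimage. Qed.

HB.instance Definition _ :=
  Measure_isFinite.Build _ _ _ (image_measure mf) image_measure_finite.

(* g is the conditional expectation of y given f, expressed on the target of f *)
Lemma conditional_density (y : T -> R) : mu.-integrable setT (EFin \o y) ->
  exists g : T' -> R,
    [/\ measurable_fun setT g, (image_measure mf).-integrable setT (EFin \o g)
      & forall A, measurable A ->
        \int[image_measure mf]_(x in A) g x = \int[mu]_(t in f @^-1` A) y t].
Proof.
move=> inty; pose nu : {charge set T -> \bar R} := induced_charge inty.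
pose nu' : {charge set T' -> \bar R} := pushforward nu f.
have dom : nu' mf `<< image_measure mf.
  apply/null_content_dominatesP => A mA A0.
  apply: null_set_integral => //; first exact: measurable_preimage.
  exact: measurable_funS (measurable_int _ inty).
pose h := Radon_Nikodym (nu' mf) (image_measure mf).
have hfin x : h x \is a fin_num by exact: Radon_Nikodym_fin_num.
have hint : (image_measure mf).-integrable setT h by exact: Radon_Nikodym_integrable.
have hE : EFin \o (fine \o h) = h by apply/funext => x /=; rewrite fineK.
exists (fine \o h); split => [||A mA]; last 1 first.
- rewrite /Rintegral; under eq_integral do rewrite /= fineK //.
  by rewrite -(Radon_Nikodym_integral dom mA).
- by apply/measurable_EFinP; rewrite hE; exact: measurable_int hint.
- by rewrite hE.
Qed.

End image_measure.

(** An open set is a countable union of boxes with rational centre and radius. The radius is taken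
    below [r / 2] because the box contains [s t] without being centred there. *)
Lemma measurable_rV d (T : measurableType d) (R : realType) n (s : T -> 'rV[R]_n) :
  (forall i, measurable_fun setT (fun t => s t 0 i)) ->
  measurable_fun setT (s : T -> borel 'rV[R]_n).
Proof.
move=> ms; apply: (@measurability _ _ T (borel 'rV[R]_n) setT s open erefl) => _ [U oU <-].
rewrite setTI.
pose box (c : 'rV[rat]_n * rat) : set 'rV[R]_n :=
  [set x | forall i, `|x 0 i - ratr (c.1 0 i)| < ratr c.2].
have -> : s @^-1` U = \bigcup_(c in [set c | box c `<=` U]) (s @^-1` box c).
  apply/seteqP; split=> t /=; last by move=> [c /= cU]; exact: cU.
  move=> Ut; have /nbhs_ballP[r /= r0 rU] : nbhs (s t) U by exact: open_nbhs_nbhs.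
  have [e /[!in_itv]/andP[/= e0 er]] := @rat_in_itvoo R 0 (r / 2) ltac:(by rewrite divr_gt0).
  have cP i : exists c : rat, `|s t 0 i - ratr c| < ratr e.
    have [c /[!in_itv]/andP[/= c1 c2]] :=
      @rat_in_itvoo R (s t 0 i - ratr e) (s t 0 i) ltac:(by rewrite ltrBlDr ltrDl).
    by exists c; rewrite ltr_norml; lra.
  have [c cE] := choice cP.
  exists (\row_i c i, e) => [x /= xc|i]; last by rewrite mxE.
  apply: rU; split => // i j; rewrite ord1 -ball_normE /=.
  have := xc j; have := cE j; rewrite !mxE.
  have := ler_distD (ratr (c j)) (s t 0 j) (x 0 j).
  by rewrite [X in _ <= _ + X]distrC; lra.
apply: countable_bigcup_measurable => c _.
have -> : s @^-1` box c =
    \bigcap_(i in [set: 'I_n]) [set t | `|s t 0 i - ratr (c.1 0 i)| < ratr c.2].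
  by apply/seteqP; split=> t /= H i => [_|]; [exact: H|exact: H i I].
apply: countable_bigcap_measurable => i _.
have mf : measurable_fun setT (fun t => `|s t 0 i - ratr (c.1 0 i)|).
  by apply: measurableT_comp => //; exact: measurable_funB.
have := mf measurableT `]-oo, ratr c.2[%classic (measurable_itv _).
by rewrite setTI; congr measurable; apply/seteqP; split=> t /=; rewrite in_itv.
Qed.

(** * Inner regularity of finite Borel measures *)

Section regularity.
Context {R : realType} {V : normedModType R}.
Variable mu : {finite_measure set (borel V) -> \bar R}.
Implicit Types B F : set (borel V).

Definition closed_inner B := forall e : R, 0 < e ->
  exists F, [/\ closed (F : set V), F `<=` B & (mu (B `\` F) <= e%:E)%E].

Lemma measurable_borel_open B : open (B : set V) -> measurable B.
Proof. exact: sub_sigma_algebra. Qed.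

Lemma measurable_borel_closed B : closed (B : set V) -> measurable B.
Proof.
move=> cB; rewrite -[B]setCK; apply: measurableC; apply: measurable_borel_open.
exact: closed_openC.
Qed.

Lemma measure_small_nonincreasing (D : nat -> set (borel V)) (e : R) :
  (forall n, measurable (D n)) -> nonincreasing_seq D -> \bigcap_n D n = set0 ->
  0 < e -> exists n, (mu (D n) <= e%:E)%E.
Proof.
move=> mD decD D0 e0.
have muD n : (mu (D n) < +oo)%E by rewrite ltey_eq fin_num_measure.
have := nonincreasing_cvg_mu (muD 0) mD (bigcapT_measurable mD) decD.
rewrite D0 measure0 => /fine_cvgP[_ /cvgrPdist_le/(_ e e0)[n _ /(_ n (leqnn n))]] /=.
rewrite sub0r normrN ger0_norm ?fine_ge0 // => mun; exists n.
by rewrite -(@fineK _ (mu (D n))) ?lee_fin // fin_num_measure.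
Qed.

(** [F n] consists of the points at distance at least [1 / (n + 1)] from the complement of [B];
    these sets increase to [B]. *)
Lemma open_closed_inner B : open (B : set V) -> closed_inner B.
Proof.
move=> oB e e0.
pose F n : set V := ~` \bigcup_(y in ~` B) ball y n.+1%:R^-1.
have cF n : closed (F n).
  by apply: open_closedC; apply: bigcup_open => y _; exact: ball_open.
have FB n : F n `<=` B.
  move=> x Fx; apply: contrapT => Bx; apply: Fx; exists x => //.
  by apply: ballxx; rewrite invr_gt0.
have mB : measurable B by exact: measurable_borel_open.
have mF n : measurable (F n : set (borel V)) by exact: measurable_borel_closed.
have [|m n mn||n Dn] := @measure_small_nonincreasing (fun n => B `\` F n) e _ _ _ e0.
- by move=> n; exact: measurableD.
- apply/subsetPset => x [Bx Fx]; split => // Fmx; apply: Fx => -[y yB yx].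
  apply: Fmx; exists y => //; apply: le_ball yx.
  by rewrite lef_pV2 ?posrE // ler_nat.
- apply/seteqP; split => // x Hx.
  have /nbhs_ballP[r /= r0 rB] : nbhs (x : V) B.
    by apply: open_nbhs_nbhs; split => //; have [] := Hx 0 I.
  pose n := Num.truncn r^-1.
  have [_] := Hx n I; apply => -[y yB /ball_sym yx]; apply: yB; apply: rB.
  apply: le_ball yx; rewrite invf_ple ?posrE //.
  exact/ltW/truncnS_gt.
- by exists (F n).
Qed.

Lemma closed_inner_closed B : closed (B : set V) -> closed_inner B.
Proof. by move=> cB e e0; exists B; split => //; rewrite setDv measure0 lee_fin ltW. Qed.

Let pow2_gt0 n : 0 < (2 ^ n.+1)%:R :> R.
Proof. by rewrite ltr0n expn_gt0. Qed.

Lemma measure_bigcup_le (D : nat -> set (borel V)) (E : set (borel V)) (e : R) :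
  (forall n, measurable (D n)) -> measurable E -> E `<=` \bigcup_n D n -> 0 <= e ->
  (forall n, (mu (D n) <= (e / (2 ^ n.+1)%:R)%:E)%E) -> (mu E <= e%:E)%E.
Proof.
move=> mD mE ED e0 De; apply: (@le_trans _ _ (\sum_(k <oo) mu (D k))%E).
  exact: measure_sigma_subadditive.
apply: (@le_trans _ _ (\sum_(k <oo) (e / (2 ^ k.+1)%:R)%:E)%E).
  exact: lee_nneseries.
exact: epsilon_trick0.
Qed.

(** Half of [e] pays for approximating each [B n] by a closed set, the other half for keeping
    finitely many of these, since an infinite union need not be closed. *)
Lemma closed_inner_bigcup (B : nat -> set (borel V)) : (forall n, measurable (B n)) ->
  (forall n, closed_inner (B n)) -> closed_inner (\bigcup_n B n).
Proof.
move=> mB Bin e e0; have e2 : 0 < e / 2 by rewrite divr_gt0.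
have [F FP] := choice (fun n => Bin n _ (divr_gt0 e2 (pow2_gt0 n))).
have mF n : measurable (F n) by apply: measurable_borel_closed; have [] := FP n.
pose G n := \bigcup_(k < n) F k.
have mG n : measurable (G n) by exact: bigcup_measurable.
have mUF : measurable (\bigcup_n F n) by exact: bigcupT_measurable.
have [|m n mn||N GN] :=
  @measure_small_nonincreasing (fun n => (\bigcup_n F n) `\` G n) _ _ _ _ e2.
- by move=> n; exact: measurableD.
- apply/subsetPset => x [Fx Gx]; split => // -[k /= km Fk]; apply: Gx; exists k => //=.
  exact: leq_trans mn.
- apply/seteqP; split => // x Hx; have [[k _ Fk] _] := Hx 0 I.
  by have [_] := Hx k.+1 I; apply; exists k => /=.
exists (G N); split.
- rewrite /G bigcup_mkord; apply: closed_bigsetU => k _; by have [] := FP k.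
- by move=> x [k _ Fk]; exists k => //; have [_ + _] := FP k; exact.
- have -> : e%:E = ((e / 2)%:E + (e / 2)%:E)%E by rewrite -EFinD -splitr.
  have mBF : measurable (\bigcup_n B n `\` \bigcup_n F n).
    by apply: measurableD => //; exact: bigcupT_measurable.
  apply: (@le_trans _ _ (mu (\bigcup_n B n `\` \bigcup_n F n) +
      mu (\bigcup_n F n `\` G N)))%E.
    rewrite -measureU //; last 2 first.
    + exact: measurableD.
    + by apply/seteqP; split => // x [[_ h] []].
    apply: le_measure; rewrite ?inE; last 1 first.
    + by move=> x [Bx Gx]; have [Fx|Fx] := pselect ((\bigcup_n F n) x); [right|left].
    + by apply: measurableD => //; exact: bigcupT_measurable.
    + by apply: measurableU => //; exact: measurableD.
  apply: leeD => //.
  apply: (@measure_bigcup_le (fun n => B n `\` F n)) => //.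
  + by move=> n; exact: measurableD.
  + move=> x [[k _ Bk] Fx]; exists k => //; split => // Fk; apply: Fx; exists k => //.
  + exact: ltW.
  + by move=> n; have [] := FP n.
Qed.

Lemma closed_inner_bigcap (B : nat -> set (borel V)) : (forall n, measurable (B n)) ->
  (forall n, closed_inner (B n)) -> closed_inner (\bigcap_n B n).
Proof.
move=> mB Bin e e0.
have [F FP] := choice (fun n => Bin n _ (divr_gt0 e0 (pow2_gt0 n))).
have mF n : measurable (F n) by apply: measurable_borel_closed; have [] := FP n.
exists (\bigcap_n F n); split.
- by apply: closed_bigI => n _; have [] := FP n.
- by move=> x Fx n _; have [_ + _] := FP n; apply; exact: Fx.
- apply: (@measure_bigcup_le (fun n => B n `\` F n)).
  + by move=> n; exact: measurableD.
  + by apply: measurableD; exact: bigcapT_measurable.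
  + move=> x [Bx Fx]; apply: contrapT => H; apply: Fx => n _.
    by apply: contrapT => Fn; apply: H; exists n => //; split => //; exact: Bx.
  + exact: ltW.
  + by move=> n; have [] := FP n.
Qed.

(** Requiring the approximation of both a set and its complement makes the class stable under
    complements; it is then a sigma-algebra containing the open sets. *)
Lemma borel_closed_inner B : measurable B -> closed_inner B.
Proof.
pose G := [set B : set (borel V) | [/\ measurable B, closed_inner B & closed_inner (~` B)]].
suff : (@measurable _ (borel V)) `<=` G by move=> /[apply] -[].
apply: smallest_sub; last first.
  move=> U oU; split; [exact: measurable_borel_open|exact: open_closed_inner|].
  by apply: closed_inner_closed; exact: open_closedC.
split.
- split; [exact: measurable0|exact/closed_inner_closed/closed0|].
  by rewrite setC0; exact/closed_inner_closed/closedT.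
- move=> D [mD D1 D2]; rewrite setTD; split => //; first exact: measurableC.
  by rewrite setCK.
- move=> D GD; split.
  + by apply: bigcupT_measurable => n; have [] := GD n.
  + by apply: closed_inner_bigcup => n; have [] := GD n.
  + rewrite setC_bigcup; apply: closed_inner_bigcap => n; have [] := GD n => //.
    by move=> mD _ _; exact: measurableC.
Qed.

End regularity.

(** A closed set that fills [B] up to [e] becomes compact when cut by [S], and the cut loses no
    mass. Thus the Radon condition in [Mplus] comes for free. *)
Lemma Mplus_concentrated {R : realType} d (S : set 'rV[R]_d)
    (sigma : {finite_measure set (borel 'rV[R]_d) -> \bar R}) :
  compact S -> sigma (~` S) = 0%E -> Mplus S sigma.
Proof.
move=> cS S0; split => // B mB.
have clS : closed S by apply: compact_closed => //; exact: norm_hausdorff.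
have mS : measurable (S : set (borel 'rV[R]_d)) by exact: measurable_borel_closed.
apply/eqP; rewrite eq_le; apply/andP; split; last first.
  apply: ub_ereal_sup => _ [K [cK KB] <-]; apply: le_measure; rewrite ?inE //.
  by apply: measurable_borel_closed; apply: compact_closed => //; exact: norm_hausdorff.
apply/lee_addgt0Pr => e e0; have [F [cF FB BF]] := borel_closed_inner sigma mB e0.
have mF : measurable F by exact: measurable_borel_closed.
apply: (@le_trans _ _ (sigma (F `&` S) + sigma (B `\` F)))%E; last first.
  apply: leeD => //; apply: ereal_sup_ubound; exists (F `&` S) => //; split.
    by rewrite setIC; exact: compact_closedI.
  by move=> x [/FB].
have mSF : measurable (F `&` S) by exact: measurableI.
have mBF : measurable (B `\` F) by exact: measurableD.
have mBS : measurable (B `\` S) by exact: measurableD.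
have BS0 : sigma (B `\` S) = 0%E.
  have mCS : measurable (~` S : set (borel 'rV[R]_d)) by exact: measurableC.
  have : (sigma (B `\` S) <= sigma (~` S))%E.
    by apply: le_measure; rewrite ?inE // => x [].
  by rewrite S0 => h; apply/eqP; rewrite eq_le h measure_ge0.
rewrite -[leRHS]adde0 -BS0.
apply: (@le_trans _ _ (sigma ((F `&` S) `|` (B `\` F) `|` (B `\` S)))).
  apply: le_measure; rewrite ?inE //; first by do 2 apply: measurableU => //.
  move=> x Bx; have [Sx|Sx] := pselect (S x); last by right.
  by left; have [Fx|Fx] := pselect (F x); [left|right].
apply: (le_trans (measureU2 _ _ _)) => //; first exact: measurableU.
by apply: leeD => //; exact: measureU2.
Qed.

Section almost_everywhere.
Context d {T : measurableType d} {R : realType}.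
Variable mu : {finite_measure set T -> \bar R}.

Lemma ae_forall_countable (I : countType) (P : I -> T -> Prop) :
  (forall i, {ae mu, forall t, P i t}) -> {ae mu, forall t, forall i, P i t}.
Proof.
move=> aeP.
have : {ae mu, forall t, forall n, if unpickle n is Some i then P i t else True}.
  by apply: ae_foralln => n; case: (unpickle n) => [i|]; [exact: aeP|exact: aeW].
by apply: filterS => t H i; have := H (pickle i); rewrite pickleK.
Qed.

(** On the part of [B] where [g] exceeds [c], the positive function [g - c] has a nonpositive
    integral, so that part is null. *)
Lemma ae_le_of_integral (B : set T) (g : T -> R) (c : R) : measurable B ->
  mu.-integrable setT (EFin \o g) ->
  (forall A, measurable A -> A `<=` B -> \int[mu]_(x in A) g x <= c * fine (mu A)) ->
  {ae mu, forall t, B t -> g t <= c}.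
Proof.
move=> mB intg gc; pose A := B `&` [set t | c < g t].
have mg : measurable_fun setT g by apply/measurable_EFinP; exact: measurable_int intg.
have mA : measurable A.
  apply: measurableI => //; have := mg measurableT `]c, +oo[%classic (measurable_itv _).
  by rewrite setTI; congr measurable; apply/seteqP; split=> t /=; rewrite in_itv /= andbT.
have intA : mu.-integrable A (EFin \o g) by exact: integrableS intg.
have intc : mu.-integrable A (EFin \o cst c) by exact: finite_measure_integrable_cst.
have intB : mu.-integrable A (EFin \o (fun t => g t - c))
  by apply: eq_integrable (integrableB mA intA intc) => // t _ /=; rewrite EFinB.
have int_le0 : \int[mu]_(t in A) (g t - c) <= 0.
  rewrite RintegralB //; rewrite (Rintegral_cst _ mA) subr_le0.
  by apply: gc => // t [].
have int0 : (\int[mu]_(t in A) `|(EFin \o (fun t => g t - c)%R) t| = 0)%E.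
  under eq_integral => t /[!inE] -[_ /= ct].
    rewrite ger0_norm ?subr_ge0 ?ltW //; over.
  apply/eqP; rewrite eq_le integral_ge0 ?andbT; last first.
    by move=> t [_ /= ct]; rewrite lee_fin subr_ge0 ltW.
  by rewrite -(@fineK _ (integral _ _ _)) ?lee_fin // integrable_fin_num.
have := (ae_eq_integral_abs mu mA (measurable_int _ intB)).1 int0.
apply: filterS => t At Bt; rewrite leNgt; apply/negP => ct.
by have := At (conj Bt ct) => /= -[]; lra.
Qed.

Lemma ae_eq0_of_integral (g : T -> R) : mu.-integrable setT (EFin \o g) ->
  (forall A, measurable A -> \int[mu]_(x in A) g x = 0) ->
  {ae mu, forall t, g t = 0}.
Proof.
move=> intg g0.
have : ae_eq mu setT (EFin \o g) (cst 0%E).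
  apply: integral_ae_eq => // E _ mE; rewrite integral0.
  have := g0 E mE; rewrite /Rintegral => h.
  by rewrite -(@fineK _ (integral _ _ _)) ?h // integrable_fin_num //; exact: integrableS intg.
by apply: filterS => t /(_ I) /= -[].
Qed.

End almost_everywhere.

(** * Bochner integrals *)

Section nonmeasurable_integrands.
Context d {T : measurableType d} {R : realType}.
Variable mu : {measure set T -> \bar R}.

(** The integral of a nonnegative function is a supremum over the simple functions below it, which
    visibly grows with the function. Integrands such as [J (u s) s] can then be compared without a
    discussion of their measurability. *)
Lemma ge0_le_integral_nomeas (D : set T) (f g : T -> \bar R) :
  (forall t, D t -> (0 <= f t)%E) -> (forall t, D t -> (f t <= g t)%E) ->
  (\int[mu]_(t in D) f t <= \int[mu]_(t in D) g t)%E.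
Proof.
move=> f0 fg; have g0 t : D t -> (0 <= g t)%E by move=> Dt; exact: le_trans (f0 t Dt) (fg t Dt).
rewrite !ge0_integralE //; apply: ereal_sup_le => _ [h hf <-]; exists h => // t.
apply: (le_trans (hf t)); rewrite /patch; case: ifPn => // /set_mem Dt; exact: fg.
Qed.

End nonmeasurable_integrands.

Section bochner_integral_theory.
Context d {T : measurableType d} {R : realType} {X : normedModType R}.
Implicit Types (g h u : T -> X) (D : set T).

Lemma simple_function_fun2 d' (U : measurableType d') (F : X -> X -> U) g h :
  simple_function g -> simple_function h -> measurable_fun setT (fun t => F (g t) (h t)).
Proof.
move=> [fg mg] [fh mh] _ B mB; rewrite setTI.
have -> : (fun t => F (g t) (h t)) @^-1` B =
    \bigcup_(p in (range g `*` range h) `&` [set p | B (F p.1 p.2)])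
      (g @^-1` [set p.1] `&` h @^-1` [set p.2]).
  apply/seteqP; split=> t /=; last by move=> [[x y] [_ /= Bxy]] [/= -> ->].
  by move=> Bt; exists (g t, h t) => //; split => //; split => /=; exists t.
apply: fin_bigcup_measurable; last by move=> p _; exact: measurableI.
by apply: finite_setIl; exact: finite_setX.
Qed.

Lemma simple_function_fun d' (U : measurableType d') (F : X -> U) g :
  simple_function g -> measurable_fun setT (F \o g).
Proof. by move=> sg; exact: (@simple_function_fun2 _ _ (fun x _ => F x) g g). Qed.

Lemma strongly_measurable_continuous D u (F : X -> R) : continuous F ->
  strongly_measurable D u -> measurable_fun D (F \o u).
Proof.
move=> cF [g sg gu]; apply: (measurable_fun_cvg (h := fun n => F \o g n)) => [n|t Dt].
  by apply: (measurable_funS measurableT) => //; exact: simple_function_fun.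
exact: (cvg_comp _ _ (gu t Dt) (cF (u t))).
Qed.

Lemma strongly_measurable_dist D u h : strongly_measurable D u -> simple_function h ->
  measurable_fun D (fun t => `|u t - h t|).
Proof.
move=> [g sg gu] sh.
apply: (measurable_fun_cvg (h := fun n t => `|g n t - h t|)) => [n|t Dt].
  apply: (measurable_funS measurableT) => //.
  exact: (@simple_function_fun2 _ _ (fun x y => `|x - y|)).
by apply: cvg_norm; apply: cvgB; [exact: gu|exact: cvg_cst].
Qed.

Variable mu : {finite_measure set T -> \bar R}.

Lemma simple_function_integrable (F : X -> R) g D : measurable D -> simple_function g ->
  mu.-integrable D (EFin \o (F \o g)).
Proof.
move=> mD sg; apply: measurable_bounded_integrable => //.
- by rewrite ltey_eq fin_num_measure.
- by apply: (measurable_funS measurableT) => //; exact: simple_function_fun.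
have [M FM] : exists M, forall x, range g x -> `|F x| <= M.
  have [fg _] := sg; exists (\sum_(x <- finmap.enum_fset (fset_set (range g))) `|F x|) => x gx.
  rewrite (big_rem x) /=; last by rewrite in_fset_set // mem_set.
  by rewrite lerDl sumr_ge0.
exists M; split; first exact: num_real.
by move=> N MN t _ /=; apply: le_trans (ltW MN); apply: FM; exists t.
Qed.

Lemma Rintegral_sum_indic (r : seq X) (a : X -> R) (A : X -> set T) D : measurable D ->
  (forall x, measurable (A x)) ->
  mu.-integrable D (EFin \o (fun t => \sum_(x <- r) a x * \1_(A x) t)) /\
  \int[mu]_(t in D) (\sum_(x <- r) a x * \1_(A x) t) =
  \sum_(x <- r) a x * fine (mu (D `&` A x)).
Proof.
move=> mD mA; elim: r => [|x r [IH1 IH2]].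
  have -> : (fun t => \sum_(x <- [::]) a x * \1_(A x) t) = cst 0.
    by apply/funext => t; rewrite big_nil.
  rewrite big_nil Rintegral_cst // mul0r; split => //.
  exact: finite_measure_integrable_cst.
have int1 : mu.-integrable D (EFin \o (\1_(A x) : T -> R)).
  by apply: (integrableS measurableT) => //; exact: integrable_indic.
have intx : mu.-integrable D (EFin \o (fun t => a x * \1_(A x) t)).
  by apply: eq_integrable (integrableZl mD (a x) int1).
have -> : (fun t => \sum_(y <- x :: r) a y * \1_(A y) t) =
    (fun t => a x * \1_(A x) t + \sum_(y <- r) a y * \1_(A y) t).
  by apply/funext => t; rewrite big_cons.
split.
  by apply: eq_integrable (integrableD mD intx IH1).
rewrite RintegralD // IH2 big_cons RintegralZl //; congr (_ * _ + _).
by rewrite /Rintegral integral_indic // setIC.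
Qed.

Lemma simple_integral_pairing (phi : X -> R) g D : scalar phi -> measurable D ->
  simple_function g -> phi (simple_integral mu D g) = \int[mu]_(t in D) phi (g t).
Proof.
move=> phis mD [fg mg].
rewrite /simple_integral fsbig_finite //= (scalar_fun_sum phis).
have [_] := Rintegral_sum_indic (finmap.enum_fset (fset_set (range g))) phi mD mg.
under [X in _ = X -> _]eq_bigr do rewrite mulrC -(scalar_funZ phis).
move=> <-; apply: eq_Rintegral => t _.
rewrite (big_rem (g t)) /=; last by rewrite in_fset_set // mem_set //; exists t.
rewrite indicE mem_set // mulr1 big_seq big1 ?addr0 // => x xr.
rewrite indicE memNset ?mulr0 // => /= gtx.
by move: xr; rewrite -gtx mem_rem_uniqF // finmap.fset_uniq.
Qed.

(** Both sides are limits of [phi (simple_integral mu D (g n))]. This identity determines Bochner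
    integrals through their pairings, uniqueness included. *)
Lemma is_bochner_integral_pairing (phi : X -> R) (M : R) u v D : scalar phi ->
  (forall x, `|phi x| <= M * `|x|) -> measurable D -> bochner_L1 mu D u ->
  is_bochner_integral mu D u v ->
  mu.-integrable D (EFin \o (phi \o u)) /\ phi v = \int[mu]_(t in D) phi (u t).
Proof.
move=> phis phiM mD [su intu] [g [sg gu gv]].
have M0 : 0 < `|M| + 1 by rewrite ltr_pwDr.
have phiM' x : `|phi x| <= (`|M| + 1) * `|x|.
  apply: (le_trans (phiM x)); apply: ler_wpM2r => //.
  by rewrite (le_trans (ler_norm _)) // lerDl.
have mphiu : measurable_fun D (phi \o u).
  exact: (strongly_measurable_continuous (bounded_scalar_continuous phis phiM)).
have mu_norm : measurable_fun D (fun t => `|u t|).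
  by apply: (strongly_measurable_continuous (F := fun x => `|x|)) => //; exact: norm_continuous.
have intn : mu.-integrable D (EFin \o (fun t => `|u t|)).
  apply/integrableP; split; first exact/measurable_EFinP.
  by under eq_integral do rewrite /= normr_id.
have intphi : mu.-integrable D (EFin \o (phi \o u)).
  apply: (@le_integrable _ _ _ _ _ mD _ (EFin \o (fun t => (`|M| + 1) * `|u t|))).
  - exact/measurable_EFinP.
  - move=> t Dt /=; rewrite lee_fin (le_trans (phiM' _)) //.
    exact: ler_norm.
  - by apply: eq_integrable (integrableZl mD (`|M| + 1) intn).
split => //.
have dist n : (`|\int[mu]_(t in D) phi (u t) - phi (simple_integral mu D (g n))|%:E <=
    (`|M| + 1)%:E * \int[mu]_(t in D) `|u t - g n t|%:E)%E.
  have intg := simple_function_integrable phi mD (sg n).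
  rewrite (simple_integral_pairing phis mD (sg n)) -RintegralB //.
  have intB : mu.-integrable D (EFin \o (fun t => phi (u t) - phi (g n t))).
    by apply: eq_integrable (integrableB mD intphi intg) => // t _ /=; rewrite EFinB.
  rewrite EFin_normr_Rintegral //; apply: (le_trans (le_abse_integral _ mD _)).
    exact: measurable_int intB.
  rewrite -ge0_integralZl_EFin //; last first.
    by apply/measurable_EFinP; exact: strongly_measurable_dist.
  apply: ge0_le_integral_nomeas => // t Dt.
  by rewrite /= -EFinM lee_fin -(scalar_funB phis).
have c1 : phi (simple_integral mu D (g n)) @[n --> \oo] --> phi v.
  by apply: continuous_cvg gv; exact: (bounded_scalar_continuous phis phiM).
apply/esym; apply: cvg_unique c1 => //.
apply/cvgrPdist_le => e e0.
have e1 : 0 < e / (`|M| + 1) by rewrite divr_gt0.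
have /fine_cvgP[gfin /cvgr0Pnorm_le /(_ _ e1) gsmall] := gu.
near=> n.
have nfin : (\int[mu]_(t in D) `|u t - g n t|%:E)%E \is a fin_num by near: n.
have nsmall : `|fine (\int[mu]_(t in D) `|u t - g n t|%:E)%E| <= e / (`|M| + 1) by near: n.
rewrite -lee_fin; apply: (le_trans (dist n)).
rewrite -(fineK nfin) -EFinM lee_fin mulrC -ler_pdivlMr //.
exact: le_trans (ler_norm _) nsmall.
Unshelve. all: by end_near. Qed.

End bochner_integral_theory.

(** * Approximation by simple functions with values in a dense sequence *)

Section simple_approximation.
Context d {T : measurableType d} {R : realType} {X : normedModType R}.
Variables (u : T -> X) (x : nat -> X).
Hypothesis mu : forall y, measurable_fun setT (fun t => `|u t - y|).
Hypothesis xdense : forall y e, 0 < e -> exists n, `|y - x n| < e.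

(** A point closest to [u t] among [0] and the first [n] terms of [x]. Including [0] bounds the
    error by [|u t|], which supplies the dominating function for convergence of the integrals. *)
Fixpoint nearest n t : X := if n is n'.+1 then
  if `|u t - x n'| < `|u t - nearest n' t| then x n' else nearest n' t else 0.

Lemma nearest_distS n t :
  `|u t - nearest n.+1 t| = Num.min `|u t - x n| `|u t - nearest n t|.
Proof. by rewrite /= minEle; case: ltgtP => // ->. Qed.

Lemma nearest_dist_le m n t : (m <= n)%N -> `|u t - nearest n t| <= `|u t - nearest m t|.
Proof.
move=> /subnK <-; elim: (n - m)%N => [|k IH]; first by rewrite add0n.
by rewrite addSn nearest_distS; apply: le_trans IH; rewrite ge_min lexx orbT.
Qed.

Lemma nearest_cvg t : nearest ^~ t @ \oo --> u t.
Proof.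
apply/cvgrPdist_lt => e e0; have [n xn] := xdense (u t) e0.
near=> m; apply: (@le_lt_trans _ _ `|u t - nearest n.+1 t|).
  by apply: nearest_dist_le; near: m; exact: nbhs_infty_ge.
by rewrite nearest_distS gt_min xn.
Unshelve. all: by end_near. Qed.

Lemma measurable_nearest_dist n : measurable_fun setT (fun t => `|u t - nearest n t|).
Proof.
elim: n => [|n IH]; first exact: mu.
under eq_fun do rewrite nearest_distS.
exact: measurable_minr.
Qed.

Lemma simple_nearest n : simple_function (nearest n).
Proof.
elim: n => [|n [fin mn]].
  split; first by apply: (sub_finite_set (B := [set 0])) => // _ [t _ <-].
  move=> y; have [->|y0] := eqVneq y 0.
    by rewrite (_ : _ @^-1` _ = setT) //; apply/seteqP; split.
  by rewrite (_ : _ @^-1` _ = set0) //; apply/seteqP; split => // t /= /esym/eqP; rewrite (negbTE y0).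
have mlt : measurable [set t | `|u t - x n| < `|u t - nearest n t|].
  have := measurable_fun_ltr (mu (x n)) (measurable_nearest_dist n).
  by move=> /(_ measurableT [set true] I); rewrite setTI.
split.
  apply: (@sub_finite_set _ _ ([set x n] `|` range (nearest n))); last by rewrite finite_setU.
  by move=> _ [t _ <-] /=; case: ifP => _; [left|right; exists t].
move=> y; have -> : nearest n.+1 @^-1` [set y] =
    ([set t | `|u t - x n| < `|u t - nearest n t|] `&` [set _ | x n = y]) `|`
    (nearest n @^-1` [set y] `\` [set t | `|u t - x n| < `|u t - nearest n t|]).
  apply/seteqP; split=> t /=; first by case: ifP => lt ty; [left|right; split => //; rewrite lt].
  by move=> [[-> //]|[<- /negP/negbTE ->]].
apply: measurableU; last exact: measurableD.
apply: measurableI => //; have [xy|xy] := pselect (x n = y).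
  by rewrite (_ : [set _ | _] = setT) //; apply/seteqP; split.
by rewrite (_ : [set _ | _] = set0) //; apply/seteqP; split.
Qed.

Lemma strongly_measurable_nearest D : strongly_measurable D u.
Proof. by exists nearest; [exact: simple_nearest|move=> t _; exact: nearest_cvg]. Qed.

Lemma nearest_integral_cvg (nu : {finite_measure set T -> \bar R}) D (C : R) :
  measurable D -> (forall t, `|u t| <= C) ->
  (fun n => \int[nu]_(t in D) `|u t - nearest n t|%:E)%E @ \oo --> 0%E.
Proof.
move=> mD uC.
have mf n : measurable_fun D (fun t => `|u t - nearest n t|%:E).
  apply/measurable_EFinP; apply: (measurable_funS measurableT) => //.
  exact: measurable_nearest_dist.
have f_cvg : {ae nu, forall t, D t -> (fun n => `|u t - nearest n t|%:E) @ \oo --> 0%E}.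
  apply: aeW => t _; apply: cvg_EFin; first by apply: nearW.
  apply/cvgrPdist_lt => e e0; have /cvgrPdist_lt/(_ e e0) := @nearest_cvg t.
  by apply: filterS => n; rewrite sub0r normrN normr_id.
have f_le : {ae nu, forall t n, D t -> (`| `|u t - nearest n t|%:E | <= C%:E)%E}.
  apply: aeW => t n _ /=; rewrite normr_id lee_fin.
  apply: le_trans (uC t); apply: (le_trans (nearest_dist_le t (leq0n n))).
  by rewrite subr0.
have [_ _] := dominated_convergence mD mf (measurable_cst 0%E) f_cvg
  (finite_measure_integrable_cst nu C mD) f_le.
by rewrite integral0.
Qed.

End simple_approximation.

(** * The unit sets of J and the reduced problem *)

Section gauge.
Context {R : realType} {X Xs : normedModType R} {iota : X -> Xs -> R}.
Hypothesis predualX : is_predual iota.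
Variable z : nat -> Xs.
Hypothesis zdense : qdense z.
Context {d : nat}.
Variables (S : set 'rV[R]_d) (J : X -> 'rV[R]_d -> \bar R) (C : R).
Hypotheses (S_compact : compact S)
  (J_ge0 : forall v s, S s -> (0 <= J v s)%E)
  (J_convex : forall s, S s -> convex_ereal (J ^~ s))
  (J_hom : forall s, S s -> pos_homogeneous (J ^~ s))
  (J_lsc : seq_lsc_on ([set: weak_star iota] `*` S)
     (fun x : X * 'rV[R]_d => J x.1 x.2))
  (C_gt0 : 0 < C)
  (J_coercive : forall v s, S s -> (`|v|%:E <= C%:E * J v s)%E).

Definition unit_set (v : X) s := S s /\ (J v s <= 1)%E.

Lemma gauge0 s : S s -> J 0 s = 0%E.
Proof. by move=> Ss; have := J_hom Ss 0 (lexx 0); rewrite scale0r mul0e. Qed.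

Lemma unit_set0 s : S s -> unit_set 0 s.
Proof. by move=> Ss; split => //; rewrite gauge0. Qed.

Lemma unit_set_norm v s : unit_set v s -> `|v| <= C.
Proof.
move=> [Ss Jv]; have := J_coercive v Ss.
by move=> /le_trans/(_ (lee_wpmul2l _ Jv)); rewrite mule1 lee_fin; apply; exact: ltW.
Qed.

Lemma unit_set_convex (t : R) v v' s : 0 <= t <= 1 ->
  unit_set v s -> unit_set v' s -> unit_set (t *: v + (1 - t) *: v') s.
Proof.
move=> t01 [Ss Jv] [_ Jv']; split => //.
apply: (le_trans (J_convex Ss v v' t01)).
have -> : 1%E = (t%:E * 1 + (1 - t)%:E * 1)%E.
  by rewrite !mule1 -EFinD addrC subrK.
by apply: leeD; apply: lee_wpmul2l => //; rewrite lee_fin; lra.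
Qed.

Lemma unit_set_limit (v : nat -> X) (s : nat -> 'rV[R]_d) v' s' :
  (forall n, unit_set (v n) (s n)) -> S s' ->
  (forall w, iota (v n) w @[n --> \oo] --> iota v' w) -> s @ \oo --> s' ->
  unit_set v' s'.
Proof.
move=> vs Ss' /weak_star_cvg vv' ss'; split => //.
pose x n : (weak_star iota * 'rV[R]_d)%type := (v n, s n).
have xx' : x @ \oo --> ((v', s') : (weak_star iota * 'rV[R]_d)%type).
  exact: (cvg_pair vv' ss').
have xJ := @J_lsc x (v', s') (fun n => conj I (vs n).1) (conj I Ss') xx'.
apply: (le_trans xJ).
rewrite limn_einf_lim; apply: lime_le; first exact: is_cvg_einfs.
apply: nearW => n; apply: le_trans (vs n).2.
by apply: ereal_inf_lbound; exists n => /=.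
Qed.

(** Sequential compactness of the graph of the unit sets: coercivity bounds the vectors, [S] is
    compact, and lower semicontinuity of [J] keeps the limit inside. *)
Lemma unit_set_extraction (v : nat -> X) (s : nat -> 'rV[R]_d) :
  (forall n, unit_set (v n) (s n)) ->
  exists phi : nat -> nat, exists v' s',
  [/\ forall j, (j <= phi j)%N, forall w, iota (v (phi j)) w @[j --> \oo] --> iota v' w,
      s (phi j) @[j --> \oo] --> s' & unit_set v' s'].
Proof.
move=> vs; have vC n : `|v n| <= C by exact: unit_set_norm (vs n).
have [M [_ SM]] := compact_bounded S_compact.
have sb i : is_bounded (fun n => s n 0 i).
  exists (M + 1) => n; apply: le_trans (SM (M + 1) _ _ (vs n).1); last by rewrite ltrDl.
  by rewrite [leRHS]/Num.norm /= mx_normrE; apply/bigmax_geP; right; exists (0, i).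
have [phi [v' [y [phij vv' sy]]]] := weak_star_extraction predualX zdense vC sb.
pose s' : 'rV[R]_d := \row_i y i.
have ss' : s (phi j) @[j --> \oo] --> s'.
  by apply: (@rV_cvg _ _ (s \o phi)) => i; rewrite mxE; exact: sy.
exists phi, v', s'; split => //.
apply: (unit_set_limit (fun n => vs (phi n))) => //.
have Scl : closed S by apply: compact_closed => //; exact: norm_hausdorff.
apply: (@closed_cvg _ _ _ _ (fun j => s (phi j)) S Scl _ s' ss').
by apply: nearW => n; exact: (vs _).1.
Qed.

(** Dividing [u] by [J u s] puts it in the unit set. If [J u s] is [0], coercivity gives [u = 0]; if
    it is infinite, [0 < c] keeps the right-hand side infinite. *)
Lemma pairing_le_gauge (w : Xs) (c : R) u s : 0 < c ->
  (forall v s', unit_set v s' -> iota v w <= c) ->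
  S s -> ((iota u w)%:E <= c%:E * J u s)%E.
Proof.
move=> c0 wc Ss; have := J_ge0 u Ss; have := J_coercive u Ss; have := J_hom Ss.
case Jj : (J u s) => [j| |] // hom; last by move=> _ _; rewrite gt0_muley ?lte_fin // leey.
rewrite -!EFinM !lee_fin => uj j0.
have [j_gt0|j_le0] := ltP 0 j.
  have : iota (j^-1 *: u) w <= c.
    apply: (wc _ s); split => //.
    by rewrite hom ?invr_ge0 // Jj -EFinM mulVf // gt_eqF.
  by rewrite (scalar_funZ (pairing_scalarl predualX w)) mulrC ler_pdivrMr.
have j00 : j = 0 by lra.
have -> : u = 0 by apply/eqP; rewrite -normr_le0 (le_trans uj) // j00 mulr0.
by rewrite (scalar_fun0 (pairing_scalarl predualX w)) j00 mulr0.
Qed.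

Lemma pairing_qspan_eq u v : (forall k, iota v (z k) = iota u (z k)) -> v = u.
Proof.
move=> uv; apply: (pairing_inj predualX) => w.
(* The density argument is reused on a constant sequence, whose limit is unique. *)
have H := @weak_star_cvg_qspan _ _ _ _ predualX z zdense (fun=> v) u `|v| (fun=> lexx _).
have /H/(_ w) : forall l, iota v (qspan z l) @[n --> \oo] --> iota u (qspan z l).
  move=> l; have -> : iota v (qspan z l) = iota u (qspan z l).
    rewrite /qspan !(scalar_fun_sum (pairing_scalar predualX _)).
    by apply: eq_bigr => p _; rewrite !(scalar_funZ (pairing_scalar predualX _)) uv.
  exact: cvg_cst.
exact: (cvg_unique _ (cvg_cst _)).
Qed.

(* v minimizes [\sum_(k < n) (iota (u - v) (z k)) ^+ 2] over the unit set; the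
   first-order condition at v tests the hypothesis on u with
   [w = \sum_(k < n) iota (u - v) (z k) *: z k]. *)
Lemma unit_set_interpolation n u s : S s ->
  (forall w M, (forall v, unit_set v s -> iota v w <= M) -> iota u w <= M) ->
  exists2 v, unit_set v s & forall k, (k < n)%N -> iota v (z k) = iota u (z k).
Proof.
move=> Ss uK.
pose q v := \sum_(k < n) (iota (u - v) (z k)) ^+ 2.
have q0 v : 0 <= q v by apply: sumr_ge0 => k _; exact: sqr_ge0.
have qlb : has_lbound [set q v | v in [set v | unit_set v s]].
  by exists 0 => _ [v _ <-].
have qinf : has_inf [set q v | v in [set v | unit_set v s]].
  by split => //; exists (q 0), 0 => //; exact: unit_set0.
pose m := inf [set q v | v in [set v | unit_set v s]].
have mq v : unit_set v s -> m <= q v by move=> Kv; apply: ge_inf => //; exists v.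
have minseq j : exists v, unit_set v s /\ q v < m + j.+1%:R^-1.
  have j0 : 0 < j.+1%:R^-1 :> R by rewrite invr_gt0.
  by have [_ [v Kv <-] qv] := inf_adherent j0 qinf; exists v.
have [v_ vP] := choice minseq.
have [phi [v [s' [phij vv ss' Kv']]]] := unit_set_extraction (fun j => (vP j).1).
have Kv : unit_set v s.
  by have <- : s' = s by exact: (cvg_unique _ ss' (cvg_cst s)).
have qv : q (v_ (phi j)) @[j --> \oo] --> q v.
  rewrite /q; elim: n {q q0 qlb qinf m mq minseq vP} => [|n IH].
    by under eq_fun do rewrite big_ord0; rewrite big_ord0; exact: cvg_cst.
  under eq_fun do rewrite big_ord_recr; rewrite big_ord_recr /=.
  apply: cvgD => //; under eq_fun do rewrite (scalar_funB (pairing_scalarl predualX _)).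
  rewrite (scalar_funB (pairing_scalarl predualX _)) /=.
  under eq_fun do rewrite expr2; rewrite expr2.
  by apply: cvgM; apply: cvgB (vv _); exact: cvg_cst.
have qvm : q v <= m.
  apply/ler_addgt0Pr => e e0.
  apply: (@cvg_seq_le _ _ _ _ (Num.truncn e^-1).+1 qv) => j je.
  apply: (le_trans (ltW (vP (phi j)).2)); rewrite lerD2l.
  rewrite invf_ple ?posrE //; apply: (le_trans (ltW (truncnS_gt _))).
  by rewrite ler_nat (leq_trans je) // (leq_trans (phij j)).
pose W := \sum_(k < n) iota (u - v) (z k) *: z k.
have pairW y : iota y W = \sum_(k < n) iota (u - v) (z k) * iota y (z k).
  rewrite /W (scalar_fun_sum (pairing_scalar predualX _)).
  by apply: eq_bigr => k _; rewrite (scalar_funZ (pairing_scalar predualX _)).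
have vW v' : unit_set v' s -> iota v' W <= iota v W.
  move=> Kv1; rewrite -subr_le0 -(scalar_funB (pairing_scalarl predualX _)).
  set b := iota (v' - v) W; rewrite leNgt; apply/negP => b0.
  pose c := \sum_(k < n) (iota (v' - v) (z k)) ^+ 2.
  have c0 : 0 <= c by apply: sumr_ge0 => k _; exact: sqr_ge0.
  have step t : 0 <= t <= 1 -> 2 * t * b <= t ^+ 2 * c.
    move=> t01; have := mq _ (unit_set_convex t01 Kv1 Kv).
    have -> : q (t *: v' + (1 - t) *: v) = q v - 2 * t * b + t ^+ 2 * c.
      rewrite /q /b pairW /c !mulr_sumr -sumrB -big_split /=; apply: eq_bigr => k _.
      have ps := pairing_scalarl predualX (z k).
      rewrite !(scalar_funB ps) (scalar_funD ps) !(scalar_funZ ps); ring.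
    by lra.
  (* Minimality gives [2 * t * b <= t ^+ 2 * c] on [0, 1]; this [t] satisfies [t * c < b], which
     contradicts it. *)
  pose t := b / (b + c).
  have bc : 0 < b + c by lra.
  have t01 : 0 <= t <= 1 by rewrite divr_ge0 ?(ltW bc) ?(ltW b0) //= ler_pdivrMr // mul1r lerDl.
  have t0 : 0 < t by exact: divr_gt0.
  have tc : t * c < b by rewrite /t mulrAC ltr_pdivrMr // ltr_pM2l //; lra.
  have : 0 < t * (2 * b - t * c) by rewrite mulr_gt0 //; lra.
  by have := step t t01; clearbody t; rewrite expr2; lra.
have := uK _ _ vW; rewrite -subr_le0 -(scalar_funB (pairing_scalarl predualX _)) pairW.
under eq_bigr do rewrite -expr2; rewrite -/(q v) => qv_le0.
have /eqP : q v = 0 by apply/eqP; rewrite eq_le qv_le0 q0.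
rewrite psumr_eq0 => [/allP H|k _]; last exact: sqr_ge0.
exists v => // k kn; have := H (Ordinal kn) (mem_index_enum _); rewrite sqrf_eq0 /=.
by rewrite (scalar_funB (pairing_scalarl predualX _)) subr_eq0 => /eqP.
Qed.

(** Weak* separation of a point from a convex compact set, obtained from finitely many dimensions:
    elements of the unit set that agree with [u] on more and more [z k] have a limit in it, and that
    limit agrees with [u] on all of them. *)
Lemma unit_set_support u s : S s ->
  (forall w M, (forall v, unit_set v s -> iota v w <= M) -> iota u w <= M) ->
  unit_set u s.
Proof.
move=> Ss uK.
have interp n : exists v, unit_set v s /\ forall k, (k < n)%N -> iota v (z k) = iota u (z k).
  by have [v ? ?] := unit_set_interpolation n Ss uK; exists v.
have [v_ vP] := choice interp.
have [phi [v [s' [phij vv ss' Kv]]]] := unit_set_extraction (fun j => (vP j).1).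
have <- : v = u.
  apply: pairing_qspan_eq => k; apply/eqP; rewrite eq_le; apply/andP; split.
    apply: (@cvg_seq_le _ _ _ _ k.+1 (vv (z k))) => j kj.
    by rewrite (vP _).2 // (leq_trans kj).
  apply: (@cvg_seq_ge _ _ _ _ k.+1 (vv (z k))) => j kj.
  by rewrite (vP _).2 // (leq_trans kj).
by have <- : s' = s by exact: (cvg_unique _ ss' (cvg_cst s)).
Qed.

(* The constraint says that v lies in m times the closed convex hull of the first
   projection of unit_set; it avoids the support function, whose value on w is
   the least M below. *)
Definition admissible (v : X) (m : R) := 0 <= m /\
  forall w M, (forall v' s, unit_set v' s -> iota v' w <= M) -> iota v w <= m * M.

(** [admissible] is exactly the domination that [mean_extension] asks of [iota v], and
    [unit_set_extraction] is the compactness that [mean_representation] asks of the coordinates,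
    namely the pairings with the [qspan z l] and the entries of [s]. *)
Lemma admissible_representation v m : S !=set0 -> admissible v m ->
  exists (mu : {finite_measure set (measurableTypeR R) -> \bar R})
         (V : measurableTypeR R -> X) (s : measurableTypeR R -> 'rV[R]_d),
  [/\ mu setT = m%:E, forall t, unit_set (V t) (s t),
      forall l, measurable_fun setT (fun t => iota (V t) (qspan z l)),
      forall i, measurable_fun setT (fun t => s t 0 i)
    & forall l, \int[mu]_t iota (V t) (qspan z l) = iota v (qspan z l)].
Proof.
move=> [s0 Ss0] [m0 vm].
pose T := {b : X * 'rV[R]_d | unit_set b.1 b.2}.
pose b0 : T := exist _ (0, s0) (unit_set0 Ss0).
pose x w (b : T) := iota (sval b).1 w.
have xs b : scalar (x ^~ b) by exact: pairing_scalar.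
have xb w : is_bounded (x w).
  exists (C * `|w|) => b; apply: (le_trans (pairing_le predualX _ _)).
  by rewrite ler_wpM2r // (unit_set_norm (svalP b)).
have [|L [L1 L2 L3]] := mean_extension xs xb (pairing_scalar predualX v) (m := m).
  move=> w M wM; apply: vm => v' s vs.
  exact: (wM (exist _ (v', s) vs)).
have Lmean : mean_on (@is_bounded R T) L m.
  split=> // [c|a f g [M fM] [N gN]]; first by exists `|c|.
  exists (`|a| * M + N) => t; apply: (le_trans (ler_normD _ _)).
  by apply: lerD => //; rewrite normrM ler_wpM2l.
pose c (i : (seq (rat * nat) + 'I_d)%type) (b : T) :=
  match i with inl l => x (qspan z l) b | inr i => (sval b).2 0 i end.
have cb i : is_bounded (c i).
  case: i => [l|i]; first exact: xb.
  have [M [_ SM]] := compact_bounded S_compact.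
  exists (M + 1) => b; apply: le_trans (SM (M + 1) _ _ (svalP b).1); last by rewrite ltrDl.
  by rewrite [leRHS]/Num.norm /= mx_normrE; apply/bigmax_geP; right; exists (0, i).
have ccompact : coordinate_compact c.
  move=> b; have [phi [v' [s' [phij vv' ss' vs']]]] :=
    unit_set_extraction (fun n => svalP (b n)).
  exists phi; split => //; exists (exist _ (v', s') vs') => -[l|i]; first exact: vv'.
  exact: (cvg_comp _ _ ss' (@coord_continuous _ _ _ 0 i s')).
have [mu [beta [muT mc intc]]] := mean_representation b0 cb Lmean ccompact.
exists mu, (fun t => (sval (beta t)).1), (fun t => (sval (beta t)).2).
split => // [t|l|i|l]; first exact: (svalP (beta t)).
- exact: (mc (inl l)).
- exact: (mc (inr i)).
- by rewrite -L3; exact: (intc (inl l)).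
Qed.

Lemma norm_le_qspan v M : 0 <= M -> (forall l, iota v (qspan z l) <= M * `|qspan z l|) ->
  `|v| <= M.
Proof.
move=> M0 vM.
have vM' w : iota v w <= M * `|w|.
  apply/ler_addgt0Pr => e e0.
  have D0 : 0 < `|v| + M + 1 by have := normr_ge0 v; lra.
  have [l wl] := @zdense w (e / (`|v| + M + 1)) ltac:(by rewrite divr_gt0).
  rewrite ltr_pdivlMr // in wl.
  have := le_pairing_norm predualX v (w - qspan z l).
  rewrite (scalar_funB (pairing_scalar predualX v)).
  have := vM l; have := ler_normB w (w - qspan z l); rewrite subKr => h1 h2 h3.
  have := ler_wpM2l M0 h1; have := normr_ge0 (w - qspan z l).
  by nra.
apply: (norm_le_pairing predualX) => w w1.
rewrite ler_norml lerNl -(scalar_funN (pairing_scalar predualX v)).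
have := vM' w; have := vM' (- w); rewrite normrN => h1 h2.
have : M * `|w| <= M by rewrite ler_piMr.
by lra.
Qed.

(** Upper semicontinuity in [s] of the support function of the unit sets, by compactness of their
    graph. It provides the Borel sets on which the support inequalities are integrated. *)
Lemma support_closed w (q : R) : closed [set s | exists2 v, unit_set v s & q <= iota v w].
Proof.
move=> s clA.
have near_s n : exists vs, unit_set vs.1 vs.2 /\ q <= iota vs.1 w /\ ball s n.+1%:R^-1 vs.2.
  have [|s' [[v vs' qv] bs']] := clA (ball s n.+1%:R^-1).
    by apply: nbhsx_ballx; rewrite invr_gt0.
  by exists (v, s').
have [b bP] := choice near_s.
have [phi [v' [s' [phij vv' ss' vs']]]] := unit_set_extraction (fun n => (bP n).1).
have ss : (b (phi j)).2 @[j --> \oo] --> s.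
  apply/cvg_ballP => e e0; near=> j; apply: le_ball (bP (phi j)).2.2.
  rewrite invf_ple ?posrE //; apply: (le_trans (ltW (truncnS_gt _))).
  rewrite ler_nat; apply: (@leq_trans (phi j)) => //; apply: leq_trans (phij j).
  by near: j; exact: nbhs_infty_ge.
have ss'E : s' = s by exact: (cvg_unique _ ss' ss).
exists v'; first by rewrite -ss'E.
by apply: (@cvg_seq_ge _ _ _ _ 0 (vv' w)) => j _; exact: (bP _).2.1.
Unshelve. all: by end_near. Qed.

(** Reduction of the support test to countably many inequalities. The strict bound is the complement
    of the closed condition in [support_closed]. *)
Lemma unit_set_support_qspan u s : S s ->
  (forall l (q : rat), (forall v, unit_set v s -> iota v (qspan z l) < ratr q) ->
    iota u (qspan z l) <= ratr q) ->
  unit_set u s.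
Proof.
move=> Ss uK; apply: unit_set_support => // w M wM.
apply/ler_addgt0Pr => e e0.
have D0 : 0 < C + `|u| + 1 by rewrite ltr_wpDl // addr_ge0 // ltW.
have e2 : 0 < e / 2 by rewrite divr_gt0.
have [l wl] := @zdense w (e / 2 / (C + `|u| + 1)) ltac:(by rewrite divr_gt0).
rewrite ltr_pdivlMr // in wl.
have n0 := normr_ge0 (w - qspan z l).
have uw := le_pairing_norm predualX u (w - qspan z l).
rewrite (scalar_funB (pairing_scalar predualX u)) in uw.
(* The window is nonempty because its length is [e] minus [C + |u|] times the distance from [w] to
   [qspan z l], and that product is below [e / 2]. *)
have [q /[!in_itv]/andP[/= q1 q2]] := @rat_in_itvoo R
  (M + C * `|w - qspan z l|) (M + e - `|u| * `|w - qspan z l|) ltac:(by nra).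
have : iota u (qspan z l) <= ratr q; last by lra.
apply: uK => v vs; apply: le_lt_trans q1.
have := le_pairing_norm predualX v (- (w - qspan z l)).
rewrite normrN (scalar_funN (pairing_scalar predualX v)).
rewrite (scalar_funB (pairing_scalar predualX v)) => h1.
have := wM v vs; have := ler_wpM2r n0 (unit_set_norm vs).
by lra.
Qed.

(** By [norm_le_qspan], a closed ball of radius [r >= 0] is cut out by countably many pairings;
    negative [r] is treated apart. *)
Lemma measurable_norm_sub d' (T : measurableType d') (u : T -> X) x :
  (forall l, measurable_fun setT (fun t => iota (u t) (qspan z l))) ->
  measurable_fun setT (fun t => `|u t - x|).
Proof.
move=> mu; apply: (measurability _ (RGenOInfty.measurableE R)) => //.
move=> _ [_ [r ->] <-]; rewrite setTI.
have [r0|r0] := ltP r 0.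
  have -> : (fun t => `|u t - x|) @^-1` `]r, +oo[ = setT; last exact: measurableT.
  by apply/seteqP; split=> t //= _; rewrite in_itv /= andbT (lt_le_trans r0).
have -> : (fun t => `|u t - x|) @^-1` `]r, +oo[ = ~` \bigcap_(l in [set: seq (rat * nat)])
    [set t | iota (u t) (qspan z l) <= iota x (qspan z l) + r * `|qspan z l|].
  rewrite -[LHS]setCK; congr (~` _); apply/seteqP; split=> t /=; last first.
    move=> H; rewrite in_itv /= andbT; apply/negP; rewrite -leNgt.
    apply: norm_le_qspan => // l.
    by have := H l I; rewrite /= (scalar_funB (pairing_scalarl predualX _)); lra.
  rewrite in_itv /= andbT => /negP; rewrite -leNgt => H l _ /=.
  have := le_pairing_norm predualX (u t - x) (qspan z l).
  rewrite (scalar_funB (pairing_scalarl predualX _)).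
  by have := ler_wpM2r (normr_ge0 (qspan z l)) H; lra.
apply: measurableC; apply: countable_bigcap_measurable => l _.
have := mu l measurableT `]-oo, iota x (qspan z l) + r * `|qspan z l|]%classic (measurable_itv _).
by rewrite setTI; congr measurable; apply/seteqP; split=> t /=; rewrite in_itv.
Qed.

(* u s has the pairings [g l s] with the qspan z l; all the inequalities and
   Q-linear relations needed to place u s in the unit set hold outside one null
   set, since there are countably many of them. *)
Theorem admissible_attained v m : S !=set0 -> admissible v m ->
  exists (sigma : {finite_measure set (borel 'rV[R]_d) -> \bar R})
         (u : borel 'rV[R]_d -> X),
  [/\ sigma (~` S) = 0%E, sigma setT = m%:E,
      forall s, if `[< S s >] then unit_set (u s) s else u s = 0,
      forall l, measurable_fun setT (fun s => iota (u s) (qspan z l))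
    & forall l, \int[sigma]_s iota (u s) (qspan z l) = iota v (qspan z l)].
Proof.
move=> S0 adm.
have [mu [V [s [muT Vs mV ms intV]]]] := admissible_representation S0 adm.
have msb := measurable_rV ms.
pose sigma : {finite_measure set (borel 'rV[R]_d) -> \bar R} := image_measure mu msb.
pose y l t := iota (V t) (qspan z l).
have yC l t : `|y l t| <= C * `|qspan z l|.
  apply: (le_trans (pairing_le predualX _ _)).
  by rewrite ler_wpM2r // (unit_set_norm (Vs t)).
have inty l : mu.-integrable setT (EFin \o y l).
  apply: measurable_bounded_integrable => //.
  - by rewrite ltey_eq fin_num_measure.
  - exact: mV.
  - exists (C * `|qspan z l|); split; first exact: num_real.
    by move=> N CN t _ /=; exact: le_trans (yC l t) (ltW CN).
have [g gP] := choice (fun l => conditional_density msb (inty l)).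
have mg l : measurable_fun setT (g l) by have [] := gP l.
have intg l : sigma.-integrable setT (EFin \o g l) by have [] := gP l.
have gE l A : measurable A -> \int[sigma]_(x in A) g l x = \int[mu]_(t in s @^-1` A) y l t.
  by have [_ _] := gP l; apply.
have mpre (A : set (borel 'rV[R]_d)) : measurable A ->
    measurable (s @^-1` A : set (measurableTypeR R)).
  by move=> mA; exact: (measurable_preimage msb mA).
have intS l (A : set (borel 'rV[R]_d)) : measurable A -> sigma.-integrable A (EFin \o g l).
  by move=> mA; exact: integrableS (intg l).
have intyS l (A : set (measurableTypeR R)) : measurable A -> mu.-integrable A (EFin \o y l).
  by move=> mA; exact: integrableS (inty l).
have intgD k l (A : set (borel 'rV[R]_d)) : measurable A ->
    sigma.-integrable A (EFin \o (fun x => g k x + g l x)).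
  by move=> mA; apply: eq_integrable (integrableD mA (intS k A mA) (intS l A mA)).
have ae_add : {ae sigma, forall x, forall p : seq (rat * nat) * seq (rat * nat),
    g (p.1 ++ p.2) x - (g p.1 x + g p.2 x) = 0}.
  apply: ae_forall_countable => -[k l] /=; apply: ae_eq0_of_integral.
    by apply: eq_integrable (integrableB measurableT (intg (k ++ l)) (intgD k l _ measurableT)).
  move=> A mA; rewrite RintegralB //; [|exact: intS|exact: intgD].
  rewrite RintegralD //; [|exact: intS|exact: intS].
  have m' := mpre A mA; rewrite !gE // -(RintegralD m' (intyS k _ m') (intyS l _ m')).
  apply/eqP; rewrite subr_eq0; apply/eqP; apply: eq_Rintegral => t _.
  by rewrite /y qspan_cat (scalar_funD (pairing_scalar predualX _)).
have ae_scale : {ae sigma, forall x, forall p : rat * seq (rat * nat),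
    g (qscale p.1 p.2) x - ratr p.1 * g p.2 x = 0}.
  apply: ae_forall_countable => -[q l] /=.
  have intqg (A : set (borel 'rV[R]_d)) : measurable A ->
      sigma.-integrable A (EFin \o (fun x => ratr q * g l x)).
    by move=> mA; apply: eq_integrable (integrableZl mA (ratr q) (intS l A mA)).
  apply: ae_eq0_of_integral.
    by apply: eq_integrable (integrableB measurableT (intg _) (intqg _ measurableT)).
  move=> A mA; rewrite RintegralB //; [|exact: intS|exact: intqg].
  rewrite RintegralZl //; last exact: intS.
  have m' := mpre A mA; rewrite !gE // -(RintegralZl (ratr q) m' (intyS l _ m')).
  apply/eqP; rewrite subr_eq0; apply/eqP; apply: eq_Rintegral => t _.
  by rewrite /y qspan_scale (scalar_funZ (pairing_scalar predualX _)).
have ae_le l c (B : set (borel 'rV[R]_d)) : measurable B -> (forall t, B (s t) -> y l t <= c) ->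
    {ae sigma, forall x, B x -> g l x <= c}.
  move=> mB yc; apply: ae_le_of_integral => // A mA AB; rewrite gE //.
  have -> : c * fine (sigma A) = \int[mu]_(t in s @^-1` A) c.
    by rewrite Rintegral_cst //; exact: mpre.
  apply: le_Rintegral; first exact: mpre.
  - by apply: intyS; exact: mpre.
  - by apply: finite_measure_integrable_cst; exact: mpre.
  - by move=> t /AB; exact: yc.
have ae_bound : {ae sigma, forall x, forall l, g l x <= C * `|qspan z l|}.
  apply: ae_forall_countable => l.
  have := @ae_le l (C * `|qspan z l|) setT measurableT.
  move=> H; apply: filterS (H _) => [x|t _]; first by apply.
  exact: le_trans (ler_norm _) (yC l t).
have mS : measurable (S : set (borel 'rV[R]_d)).
  by apply: measurable_borel_closed; apply: compact_closed => //; exact: norm_hausdorff.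
have ae_support : {ae sigma, forall x, forall p : seq (rat * nat) * rat,
    (S x /\ forall v, unit_set v x -> iota v (qspan z p.1) < ratr p.2) ->
    g p.1 x <= ratr p.2}.
  apply: ae_forall_countable => -[l q] /=.
  apply: (@ae_le l (ratr q) [set x | S x /\ forall v, unit_set v x -> iota v (qspan z l) < ratr q]).
    have -> : [set x | S x /\ forall v, unit_set v x -> iota v (qspan z l) < ratr q] =
        S `\` [set x | exists2 v, unit_set v x & ratr q <= iota v (qspan z l)].
      apply/seteqP; split=> x /= [Sx H]; split => //.
        by move=> [v' /H]; rewrite ltNge => /negP.
      by move=> v' v'x; rewrite ltNge; apply/negP => qv; apply: H; exists v'.
    by apply: measurableD => //; apply: measurable_borel_closed; exact: support_closed.
  by move=> t [_ H]; exact/ltW/H.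
have sigmaS : sigma (~` S) = 0%E.
  rewrite -[LHS]/(mu (s @^-1` (~` S))).
  have -> : s @^-1` (~` S) = set0; last exact: measure0.
  by apply/seteqP; split => // t /=; apply; exact: (Vs t).1.
have ae_S : {ae sigma, forall x, S x}.
  by exists (~` S); split => //; exact: measurableC.
pose good x := [/\ S x,
    forall p : seq (rat * nat) * seq (rat * nat), g (p.1 ++ p.2) x - (g p.1 x + g p.2 x) = 0,
    forall p : rat * seq (rat * nat), g (qscale p.1 p.2) x - ratr p.1 * g p.2 x = 0,
    forall l, g l x <= C * `|qspan z l|
  & forall p : seq (rat * nat) * rat,
    (S x /\ forall v, unit_set v x -> iota v (qspan z p.1) < ratr p.2) ->
    g p.1 x <= ratr p.2].
have [N [mN N0 Ngood]] : {ae sigma, forall x, good x}.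
  have F : Filter (almost_everywhere sigma) := ae_filter_ringOfSetsType sigma.
  have := @filterI _ _ F _ _ ae_S (@filterI _ _ F _ _ ae_add
    (@filterI _ _ F _ _ ae_scale (@filterI _ _ F _ _ ae_bound ae_support))).
  by apply: (@filterS _ _ F) => x [? [? [? [? ?]]]]; split.
(* Setting [u] to [0] on the measurable null set [N] keeps its pairings measurable: they become
   [g l] times the indicator of the complement of [N]. Points outside [S] are not [good], so they
   lie in [N]. *)
have uex x : exists w, (N x -> w = 0) /\ (~ N x -> unit_set w x /\ forall l, iota w (qspan z l) = g l x).
  have [Nx|Nx] := pselect (N x); first by exists 0.
  have [Sx gD gZ gC gs] : good x by apply: contrapT => H; apply: Nx; exact: Ngood.
  have [k l|q l|l|w wE] := qspan_extension predualX zdense (a := g ^~ x) (ltW C_gt0).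
  - by apply/eqP; rewrite -subr_eq0; apply/eqP; exact: (gD (k, l)).
  - by apply/eqP; rewrite -subr_eq0; apply/eqP; exact: (gZ (q, l)).
  - exact: gC.
  exists w; split => // _; split => //; apply: unit_set_support_qspan => // l q H.
  by rewrite wE; exact: (gs (l, q)).
have [u uP] := choice uex.
have uE l : (fun x => iota (u x) (qspan z l)) = (fun x => g l x * \1_(~` N) x).
  apply/funext => x; rewrite indicE; have [Nx|Nx] := pselect (N x).
    rewrite memNset ?mulr0; last by move=> /(_ Nx).
    by rewrite (uP x).1 // (scalar_fun0 (pairing_scalarl predualX _)).
  by rewrite mem_set // mulr1 ((uP x).2 Nx).2.
have mu' l : measurable_fun setT (fun x => iota (u x) (qspan z l)).
  by rewrite uE; apply: measurable_funM => //; apply: measurable_indic; exact: measurableC.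
exists sigma, u; split => // [x|l].
- case: asboolP => Sx; last by apply: (uP x).1; apply: Ngood => -[].
  by have [Nx|Nx] := pselect (N x); [rewrite (uP x).1 //; exact: unit_set0|exact: ((uP x).2 Nx).1].
- rewrite -intV.
  have -> : \int[mu]_t iota (V t) (qspan z l) = \int[sigma]_x g l x.
    by rewrite gE // preimage_setT.
  congr fine; apply: ae_eq_integral => //; try exact/measurable_EFinP.
  exists N; split => // x /= H; apply: contrapT => Nx; apply: H => _.
  by rewrite ((uP x).2 Nx).2.
Qed.

(** * Passage between admissible pairs and the original problem *)

Variable x : nat -> X.
Hypotheses (xdense : forall v e, 0 < e -> exists n, `|v - x n| < e) (S_neq0 : S !=set0).

Let mS : measurable (S : set (borel 'rV[R]_d)).
Proof.
by apply: measurable_borel_closed; apply: compact_closed => //; exact: norm_hausdorff.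
Qed.

Lemma admissible_energy v m : admissible v m ->
  exists (sigma : {finite_measure set (borel 'rV[R]_d) -> \bar R})
         (u : borel 'rV[R]_d -> X),
  [/\ Mplus S sigma, bochner_L1 sigma S u, bochner_integral sigma S u = v
    & (energy J S u sigma <= m%:E)%E].
Proof.
move=> /(admissible_attained S_neq0)[sigma [u [sigmaS sigmaT uS mu intu]]].
have uS1 s : S s -> unit_set (u s) s by move=> Ss; have := uS s; rewrite asboolT.
have uC s : `|u s| <= C.
  have := uS s; case: asboolP => Ss us; last by rewrite us normr0 ltW.
  exact: (unit_set_norm us).
have mnorm y := measurable_norm_sub y mu.
have su : strongly_measurable (S : set (borel 'rV[R]_d)) u.
  exact: strongly_measurable_nearest mnorm xdense _.
have L1u : bochner_L1 sigma S u.
  split => //; apply: (@le_lt_trans _ _ (\int[sigma]_(s in S) C%:E)%E).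
    by apply: ge0_le_integral_nomeas => s Ss; rewrite lee_fin.
  rewrite integral_cst // lte_mul_pinfty ?lee_fin ?ltW //.
  by rewrite ltey_eq fin_num_measure.
have intSu l : \int[sigma]_(s in S) iota (u s) (qspan z l) = iota v (qspan z l).
  rewrite -intu Rintegral_mkcond; congr fine; apply: eq_integral => s _.
  congr EFin; rewrite /patch; case: ifPn => // /negP Ss.
  have := uS s; rewrite asboolF => [->|Ss']; last by apply: Ss; rewrite inE.
  by rewrite (scalar_fun0 (pairing_scalarl predualX _)).
have pairM l y : `|iota y (qspan z l)| <= `|qspan z l| * `|y|.
  by rewrite mulrC; exact: pairing_le.
pose g := nearest u x.
have gu := nearest_integral_cvg mnorm xdense sigma mS uC.
have int_iota l : sigma.-integrable S (EFin \o (fun s => iota (u s) (qspan z l))).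
  apply: measurable_bounded_integrable => //.
  - by rewrite ltey_eq fin_num_measure.
  - exact: measurable_funS (mu l).
  - exists (`|qspan z l| * C); split; first exact: num_real.
    move=> N CN s _ /=; apply: le_trans (ltW CN); apply: (le_trans (pairM l _)).
    by rewrite ler_wpM2l.
(* So far [v] is linked to [u] only by pairings with the [qspan z l], so the norm is estimated
   through [norm_le_qspan]. *)
have distE n : (`|v - simple_integral sigma S (g n)|%:E <=
    \int[sigma]_(s in S) `|u s - g n s|%:E)%E.
  have fin : (\int[sigma]_(s in S) `|u s - g n s|%:E)%E \is a fin_num.
    apply: integrable_fin_num => //; apply: measurable_bounded_integrable => //.
    - by rewrite ltey_eq fin_num_measure.
    - by apply: (measurable_funS measurableT) => //; exact: measurable_nearest_dist.
    - exists C; split; first exact: num_real.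
      move=> N CN s _ /=; rewrite normr_id; apply: le_trans (ltW CN).
      apply: le_trans (uC s); apply: (le_trans (nearest_dist_le u x s (leq0n n))).
      by rewrite subr0.
  rewrite -(fineK fin) lee_fin; apply: norm_le_qspan.
    by apply: fine_ge0; apply: integral_ge0 => s _; rewrite lee_fin.
  move=> l; rewrite (scalar_funB (pairing_scalarl predualX _)) -intSu.
  have sg := simple_nearest x mnorm n.
  have ps := pairing_scalarl predualX (qspan z l).
  rewrite (simple_integral_pairing sigma ps mS sg).
  have intg := simple_function_integrable sigma (iota ^~ (qspan z l)) mS sg.
  rewrite -RintegralB //.
  have intB : sigma.-integrable S (EFin \o
      (fun s => iota (u s) (qspan z l) - iota (g n s) (qspan z l))).
    by apply: eq_integrable (integrableB mS (int_iota l) intg) => // t _ /=; rewrite EFinB.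
  apply: (le_trans (ler_norm _)); rewrite -lee_fin EFin_normr_Rintegral //.
  apply: (le_trans (le_abse_integral _ mS (measurable_int _ intB))).
  rewrite EFinM fineK // muleC -ge0_integralZl_EFin //; last first.
    apply/measurable_EFinP; apply: (measurable_funS measurableT) => //.
    exact: measurable_nearest_dist.
  apply: ge0_le_integral_nomeas => // s Ss.
  by rewrite /= -EFinM lee_fin -(scalar_funB ps).
have is_bochner : is_bochner_integral sigma S u v.
  exists g; split => //; first exact: simple_nearest.
  apply/cvgrPdist_lt => e e0.
  have /fine_cvgP[gfin /cvgr0Pnorm_lt /(_ _ e0) gsmall] := gu.
  near=> n.
  have nfin : (\int[sigma]_(t in S) `|u t - g n t|%:E)%E \is a fin_num by near: n.
  have nsmall : `|fine (\int[sigma]_(t in S) `|u t - g n t|%:E)%E| < e by near: n.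
  have := distE n; rewrite -(fineK nfin) lee_fin => /le_lt_trans; apply.
  exact: le_lt_trans (ler_norm _) nsmall.
(* [bochner_integral] is some chosen integral of [u]; its pairings identify it with [v]. *)
have bochnerE : bochner_integral sigma S u = v.
  have /xgetPex : exists w, is_bochner_integral sigma S u w by exists v.
  move=> /(_ 0) => bu; apply: pairing_qspan_eq => k.
  have := (is_bochner_integral_pairing (pairing_scalarl predualX (qspan z [:: (1, k)]))
    (pairM _) mS L1u bu).2.
  by rewrite -/(bochner_integral sigma S u) intSu !qspan1.
exists sigma, u; split => //; first exact: Mplus_concentrated.
apply: (@le_trans _ _ (\int[sigma]_(s in S) (cst 1%E) s)%E).
  by apply: ge0_le_integral_nomeas => s Ss; [exact: J_ge0|exact: (uS1 s Ss).2].
rewrite integral_cst // mul1e -sigmaT; apply: le_measure; rewrite ?inE //.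
Unshelve. all: by end_near. Qed.

Lemma feasible_admissible (sigma : {finite_measure set (borel 'rV[R]_d) -> \bar R}) u m :
  bochner_L1 sigma (S : set (borel 'rV[R]_d)) u -> energy J S u sigma = m%:E ->
  admissible (bochner_integral sigma (S : set (borel 'rV[R]_d)) u) m.
Proof.
move=> L1u em; have m0 : 0 <= m.
  by rewrite -lee_fin -em; apply: integral_ge0 => s Ss; exact: J_ge0.
split=> // w M wM; have ps := pairing_scalarl predualX w.
have M0 : 0 <= M.
  by have [s Ss] := S_neq0; have := wM 0 s (unit_set0 Ss); rewrite (scalar_fun0 ps).
(* If no vector qualifies as an integral, [bochner_integral] takes the default value [0], for which
   the inequality is clear. *)
have [ex|nex] := pselect (exists v, is_bochner_integral sigma (S : set (borel 'rV[R]_d)) u v); last first.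
  rewrite /bochner_integral xgetPN; last by move=> v bv; apply: nex; exists v.
  by rewrite (scalar_fun0 ps) mulr_ge0.
have bu : is_bochner_integral sigma (S : set (borel 'rV[R]_d)) u
  (bochner_integral sigma (S : set (borel 'rV[R]_d)) u) by exact: xgetPex ex.
have wle y : `|iota y w| <= `|w| * `|y| by rewrite mulrC; exact: pairing_le.
have [intw ->] := is_bochner_integral_pairing ps wle mS L1u bu.
(* [M] may be [0], whereas [pairing_le_gauge] divides by a positive bound; this [c] is positive and
   [m * c <= m * M + e]. *)
apply/ler_addgt0Pr => e e0; pose c := M + e / (m + 1).
have c0 : 0 < c by rewrite ltr_wpDl // divr_gt0 //; lra.
have wc v s : unit_set v s -> iota v w <= c.
  by move=> vs; apply: le_trans (wM v s vs) _; rewrite lerDl divr_ge0 ?ltW //; lra.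
(* The positive part is an integrable minorant of [J (u s) s], and its sign permits the comparison
   of integrals. *)
pose f s := Num.max (c^-1 * iota (u s) w) 0.
have intc : sigma.-integrable S (EFin \o (fun s => c^-1 * iota (u s) w)).
  by apply: eq_integrable (integrableZl mS c^-1 intw).
have intf : sigma.-integrable S (EFin \o f).
  apply: (@le_integrable _ _ _ _ _ mS _ _ _ _ intc).
    apply/measurable_EFinP; apply: measurable_maxr => //.
    by apply/measurable_EFinP; exact: measurable_int intc.
  move=> s Ss /=; rewrite lee_fin /f.
  by case: (lerP 0 (c^-1 * iota (u s) w)) => // _; rewrite normr0.
have fJ s : S s -> ((f s)%:E <= J (u s) s)%E.
  move=> Ss; rewrite /f EFin_max ge_max J_ge0 // andbT.
  have := @pairing_le_gauge w c (u s) s c0 wc Ss.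
  by rewrite EFinM lee_pdivrMl.
have : \int[sigma]_(s in S) f s <= m.
  rewrite -lee_fin -em /Rintegral fineK; last exact: integrable_fin_num.
  by apply: ge0_le_integral_nomeas => // s Ss; rewrite lee_fin /f le_max lexx orbT.
have : \int[sigma]_(s in S) (c^-1 * iota (u s) w) <= \int[sigma]_(s in S) f s.
  by apply: le_Rintegral => // s _; rewrite /f le_max lexx.
rewrite RintegralZl // => h1 h2; have := le_trans h1 h2.
rewrite ler_pdivrMl // => /le_trans; apply; rewrite /c mulrDl mulrC lerD2l.
by rewrite mulrAC ler_pdivrMr ?ler_pM2l //; lra.
Qed.

Lemma admissible0 : admissible 0 0.
Proof.
by split=> // w M _; rewrite mul0r (scalar_fun0 (pairing_scalarl predualX w)).
Qed.

Lemma admissible_norm v m : admissible v m -> `|v| <= m * C.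
Proof.
move=> [m0 vm]; have H w : iota v w <= m * C * `|w|.
  rewrite -mulrA; apply: vm => v' s /unit_set_norm v'C.
  apply: (le_trans (le_pairing_norm predualX _ _)).
  by rewrite ler_wpM2r.
by apply: norm_le_qspan => [|l]; [rewrite mulr_ge0 // ltW|exact: H].
Qed.

(** The fidelity term is handled by a minorant that is affine and weakly continuous: [|a| ^+ 2 / 2]
    is at least [psi a / 2 - |y| ^+ 2 / 2], with equality at the residual [y] of the limit. *)
Lemma admissible_argmin (Y : normedModType R) (ip : {dot Y for @idfun R})
    (A : {linear X -> Y}) (f : Y) (alpha : R) :
  is_inner_product ip -> weak_star_to_weak_continuous iota A -> 0 < alpha ->
  exists v m, admissible v m /\ forall v' m', admissible v' m' ->
    `|A v - f| ^+ 2 / 2 + alpha * m <= `|A v' - f| ^+ 2 / 2 + alpha * m'.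
Proof.
move=> ipY A_cont alpha0.
pose F (p : X * R) : R := `|A p.1 - f| ^+ 2 / 2 + alpha * p.2.
pose E : set R := [set F p | p in [set p | admissible p.1 p.2]].
have sq0 y : 0 <= `|y : Y| ^+ 2 / 2 by rewrite divr_ge0 // sqr_ge0.
have F0 p : admissible p.1 p.2 -> 0 <= F p.
  by move=> [p0 _]; rewrite addr_ge0 // mulr_ge0 // ltW.
have Elb : has_lbound E by exists 0 => _ [p ap <-]; exact: F0.
have Einf : has_inf E by split => //; exists (F (0, 0)), (0, 0) => //; exact: admissible0.
have seq n : exists p, admissible p.1 p.2 /\ F p < inf E + n.+1%:R^-1.
  have n0 : 0 < n.+1%:R^-1 :> R by rewrite invr_gt0.
  by have [_ [p ap <-] Fp] := inf_adherent n0 Einf; exists p.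
have [p pP] := choice seq.
(* All values of the minimizing sequence are within [1] of the infimum, and the fidelity term is
   nonnegative. *)
pose B : R := (inf E + 1) / alpha.
have pB n : 0 <= (p n).2 <= B.
  have [[p0 _] Fp] := pP n; rewrite p0 /= ler_pdivlMr // mulrC.
  have n1 : n.+1%:R^-1 <= 1 :> R by rewrite invf_le1 // ler1n.
  apply: (@le_trans _ _ (F (p n))); first by rewrite lerDr.
  by apply: (le_trans (ltW Fp)); rewrite lerD2l.
have vB n : `|(p n).1| <= B * C.
  apply: (le_trans (admissible_norm (pP n).1)); rewrite ler_pM2r //.
  by have /andP[] := pB n.
have mb (i : unit) : is_bounded (fun n => (p n).2).
  by exists B => n; have /andP[p0 pB'] := pB n; rewrite ger0_norm.
have [phi [v [m_ [phij vv mm]]]] := weak_star_extraction predualX zdense vB mb.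
pose m := m_ tt; have {}mm : (p (phi j)).2 @[j --> \oo] --> m by exact: mm tt.
have adm : admissible v m.
  split; first by apply: (@cvg_seq_ge _ _ _ _ 0 mm) => j _; have /andP[] := pB (phi j).
  move=> w M wM; rewrite -subr_le0.
  have c : iota (p (phi j)).1 w - (p (phi j)).2 * M @[j --> \oo] --> iota v w - m * M.
    by apply: cvgB => //; exact: cvgMl.
  apply: (@cvg_seq_le _ _ _ _ 0 c) => j _; rewrite subr_le0.
  exact: (pP (phi j)).1.2.
exists v, m; split => // v' m' adm'.
have infF : inf E <= F (v', m') by apply: ge_inf => //; exists (v', m').
apply: le_trans infF; set y := A v - f.
have dualy := sym_inner_dual ipY y.
pose psi b := ip b y + ip y b.
have ipyy : psi y = 2 * `|y| ^+ 2 by rewrite /psi ipY; ring.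
have c1 := weak_star_to_weak_cvg A_cont dualy vv.
have c2 : psi (A (p (phi j)).1 - f) / 2 - `|y| ^+ 2 / 2 + alpha * (p (phi j)).2
    @[j --> \oo] --> psi y / 2 - `|y| ^+ 2 / 2 + alpha * m.
  apply: cvgD; last exact: cvgMr.
  apply: cvgB; last exact: cvg_cst.
  apply: cvgMl; rewrite /psi.
  under eq_fun do rewrite (scalar_funB dualy.1).
  rewrite (scalar_funB dualy.1).
  by apply: cvgB; [exact: c1|exact: cvg_cst].
have -> : `|y| ^+ 2 / 2 + alpha * m = psi y / 2 - `|y| ^+ 2 / 2 + alpha * m.
  by rewrite ipyy; field.
apply/ler_addgt0Pr => e e0.
apply: (@cvg_seq_le _ _ _ _ (Num.truncn e^-1).+1 c2) => j je.
apply: (@le_trans _ _ (F (p (phi j)))).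
  rewrite -[F _]/(`|A (p (phi j)).1 - f| ^+ 2 / 2 + alpha * (p (phi j)).2).
  have := sqr_ge0 (`|A (p (phi j)).1 - f - y|).
  rewrite (sym_inner_sqnormB ipY) -/(psi _) => sq.
  move: sq; move: (`|_| ^+ 2) (psi _) (`|y| ^+ 2) (alpha * _) => a b c1' c2' sq.
  by lra.
apply: (le_trans (ltW (pP (phi j)).2)); rewrite lerD2l.
rewrite invf_ple ?posrE //; apply: (le_trans (ltW (truncnS_gt _))).
by rewrite ler_nat (leq_trans je) // (leq_trans (phij j)).
Qed.
End gauge.

Theorem corollary3p7 (R : realType)
  (X Xs Y : completeNormedModType R)
  (iota : X -> Xs -> R) (ip : {dot Y for @idfun R})
  (A : {linear X -> Y}) (f : Y) (alpha : R)
  (d : nat) (S : set 'rV[R]_d) (J : X -> 'rV[R]_d -> \bar R)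
  (sepX : separable X) (predualX : is_predual iota)
  (sepY : separable Y) (hilbertY : is_inner_product ip)
  (A_cont : weak_star_to_weak_continuous iota A)
  (alpha_gt0 : 0 < alpha)
  (S_neq0 : S !=set0) (S_compact : compact S)
  (J_ge0 : forall v s, S s -> (0 <= J v s)%E)
  (J_proper : proper_on ([set: X] `*` S)
     (fun x : X * 'rV[R]_d => J x.1 x.2))
  (J_borel : borel_measurable_on ([set: X] `*` S)
     (fun x : X * 'rV[R]_d => J x.1 x.2))
  (H1 : forall s, S s ->
     [/\ proper_on [set: X] (J ^~ s), convex_ereal (J ^~ s)
       & pos_homogeneous (J ^~ s)])
  (H2 : seq_lsc_on ([set: weak_star iota] `*` S)
     (fun x : weak_star iota * 'rV[R]_d => J x.1 x.2))
  (H3 : exists2 C : R, 0 < C &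
     forall v s, S s -> (`|v|%:E <= C%:E * J v s)%E) :
  exists sigma : {finite_measure set (borel 'rV[R]_d) -> \bar R},
  exists u : 'rV[R]_d -> X,
    [/\ Mplus S sigma,
        bochner_L1 sigma S u,
        forall (sigma' : {finite_measure set (borel 'rV[R]_d) -> \bar R})
               (u' : 'rV[R]_d -> X),
          Mplus S sigma' -> bochner_L1 sigma' S u' ->
          (objective_L1 J S A f alpha u sigma
             <= objective_L1 J S A f alpha u' sigma')%E
      & forall (v : X)
               (sigma' : {finite_measure set (borel 'rV[R]_d) -> \bar R}),
          Mplus S sigma' ->
          (objective J S A f alpha (bochner_integral sigma S u) sigma
             <= objective J S A f alpha v sigma')%E].
Proof.
have [C C_gt0 J_coercive] := H3.
have J_convex s : S s -> convex_ereal (J ^~ s) by case/H1.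
have J_hom s : S s -> pos_homogeneous (J ^~ s) by case/H1.
have [x xdense] := separable_dense_seq sepX.
have [z zdense] := separable_predual sepX predualX.
have [v [m [adm vmin]]] :=
  admissible_argmin predualX zdense C_gt0 J_coercive f hilbertY A_cont alpha_gt0.
have [sigma [u [sigmaS L1u uv um]]] := admissible_energy predualX zdense S_compact
  J_ge0 J_convex J_hom H2 C_gt0 J_coercive xdense S_neq0 adm.
have energy_ge0 u' sigma' : (0 <= energy J S u' sigma')%E.
  by apply: integral_ge0 => s Ss; exact: J_ge0.
have alpha_ge0 : (0 <= alpha%:E)%E by rewrite lee_fin ltW.
have min_L1 (sigma' : {finite_measure set (borel 'rV[R]_d) -> \bar R}) u' :
    bochner_L1 sigma' (S : set (borel 'rV[R]_d)) u' ->
    (objective_L1 J S A f alpha u sigma <= objective_L1 J S A f alpha u' sigma')%E.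
  move=> L1u'; have := energy_ge0 u' sigma'.
  (* A competitor of infinite energy has an infinite objective. One of finite energy [m'] yields an
     admissible pair, while the energy of [u] is at most the optimal [m]. *)
  rewrite {2}/objective_L1; case em' : (energy J S u' sigma') => [m'| |] // _; last first.
    by rewrite gt0_muley ?lte_fin // addey // leey.
  have adm' := feasible_admissible predualX S_compact J_ge0 J_hom J_coercive
    S_neq0 L1u' em'.
  apply: (@le_trans _ _ (`|A v - f| ^+ 2 / 2 + alpha * m)%:E).
    rewrite /objective_L1 uv EFinD (EFinM alpha); apply: leeD2l.
    exact: lee_wpmul2l.
  by rewrite -EFinM lee_fin; exact: vmin.
exists sigma, u; split => // [sigma' u' _|v' sigma' _]; first exact: min_L1.
(* [u] is a candidate in the infimal convolution at its own integral, so the second objective is at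
   most the first there. For the converse bound, the finite fidelity term and the factor [alpha] are
   moved across so that each candidate [u'] for [v'] is tested by the first problem; with no
   candidate the infimum is infinite. *)
apply: (@le_trans _ _ (objective_L1 J S A f alpha u sigma)).
  apply: leeD2l; apply: lee_wpmul2l => //.
  by apply: ereal_inf_lbound; exists u.
rewrite /objective -leeBlDl // -lee_pdivrMl //; apply: le_ereal_inf_tmp => _ [u' [L1u' <-] <-].
by rewrite lee_pdivrMl // leeBlDl //; exact: min_L1.
Qed.
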